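(* Let $p\geq 3$ be a prime, let $\phi(x)=\frac{ax+b}{cx+d}$ with $a,b,c,d\in\mathbb{Q}_p$, $ad-bc\ne0$, let $\Delta=(d-a)^2+4bc$ with $\sqrt{\Delta}\notin\mathbb{Q}_p$, and suppose that $\lambda=\frac{a+d+\sqrt{\Delta}}{a+d-\sqrt{\Delta}}$ is not a root of unity and that $\mathbb{Q}_p(\sqrt{\Delta})$ is an unramified quadratic extension of $\mathbb{Q}_p$. Let $r_0=|\sqrt{\Delta}/c|_p$, let $\eta\in\mathbb{Q}_p$ with $|\eta|_p=r_0$, and set $h(x)=\eta x+\frac{a-d}{2c}$. If $(B,\phi)$ is a minimal subsystem of $(\mathbb{P}^1(\mathbb{Q}_p),\phi)$, then the unique invariant (Borel probability) measure $\hat\sigma$ of the system $(B,\phi)$ is given, for each measurable subset $A\subset B$, by $$\hat\sigma(A)=\frac{\hat\mu(h^{-1}(A))}{\hat\mu(h^{-1}(B))}.$$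
   Context: $\mathbb{P}^1(\mathbb{Q}_p)=\mathbb{Q}_p\cup\{\infty\}$ with its usual compact topology; $|\cdot|_p$ is extended to $\mathbb{Q}_p(\sqrt\Delta)$; $h$ is extended to $\mathbb{P}^1(\mathbb{Q}_p)$ by $h(\infty)=\infty$. (The hypothesis $\sqrt\Delta\notin\mathbb{Q}_p$ forces $c\ne 0$.) A subsystem is a pair $(B,\phi)$ with $B$ nonempty compact and $\phi(B)\subset B$; it is minimal if $B=\overline{\{\phi^n(x):n\ge0\}}$ for every $x\in B$. Let $\mu_0$ be the Haar probability measure on $\mathbb{Z}_p$ and $\xi:\mathbb{P}^1(\mathbb{Q}_p)\to\mathbb{P}^1(\mathbb{Q}_p)$, $\xi(z)=1/z$. For a Borel set $S\subset\mathbb{P}^1(\mathbb{Q}_p)$ put $S_1=\mathbb{Z}_p\cap S$, $S_2=(\mathbb{P}^1(\mathbb{Q}_p)\setminus\mathbb{Z}_p)\cap S$ (so $\xi^{-1}(S_2)\subset p\mathbb{Z}_p$), and define the probability measure $$\hat\mu(S):=\frac{p}{p+1}\bigl(\mu_0(S_1)+\mu_0(\xi^{-1}(S_2))\bigr).$$ *)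

(* Defs.v *)
From HB Require Import structures.
From mathcomp Require Import all_boot all_order all_algebra all_field.
From mathcomp Require Import all_classical all_reals all_analysis.
Set Implicit Arguments.
Unset Strict Implicit.
Unset Printing Implicit Defensive.
Import Order.TTheory GRing.Theory Num.Theory.
Local Open Scope classical_set_scope.
Local Open Scope ring_scope.
Local Open Scope quotient_scope.

(* For x <> 0 this is p ^ (- v_p x). *)
Definition rat_pabs (p : nat) (x : rat) : rat :=
  if x == 0 then 0
  else p%:R ^+ logn p `|denq x|%N / p%:R ^+ logn p `|numq x|%N.

Section RatPabs.
Variables (p : nat) (p_pr : prime p).
Local Notation N := (rat_pabs p).

Let p_gt0 : 0 < p%:R :> rat.
Proof. by rewrite ltr0n prime_gt0. Qed.

Let p_neq0 : p%:R != 0 :> rat.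
Proof. by rewrite gt_eqF. Qed.

Let p_gt1 : 1 < p%:R :> rat.
Proof. by rewrite ltr1n prime_gt1. Qed.

Let powp_gt0 n : 0 < p%:R ^+ n :> rat.
Proof. by rewrite exprn_gt0. Qed.

Lemma rat_pabs0 : N 0 = 0.
Proof. by rewrite /rat_pabs eqxx. Qed.

Lemma rat_pabs_frac (m n : int) : m != 0 -> n != 0 ->
  N (m%:~R / n%:~R) = p%:R ^+ logn p `|n|%N / p%:R ^+ logn p `|m|%N.
Proof.
move=> m0 n0; set x := _%:~R / _.
have x0 : x != 0 by rewrite /x mulf_neq0 ?invr_eq0 ?intr_eq0.
rewrite /rat_pabs (negPf x0).
apply/eqP; rewrite eqr_div ?expf_neq0 // -!exprD; apply/eqP; congr (_ ^+ _).
have e : (m * denq x = numq x * n)%R.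
  apply/eqP; rewrite -(eqr_int rat) !rmorphM /=.
  have : x * n%:~R = m%:~R by rewrite /x divfK // intr_eq0.
  by move=> <-; rewrite numqE mulrAC.
have := congr1 (fun z : int => logn p `|z|%N) e.
rewrite !abszM !lognM ?absz_gt0 ?denq_neq0 ?numq_eq0 // => h.
by rewrite addnC h addnC.
Qed.

Lemma rat_pabs_eq0 x : (N x == 0) = (x == 0).
Proof.
rewrite /rat_pabs; case: ifP => [_|//]; first by rewrite eqxx.
by move=> _; rewrite gt_eqF // divr_gt0.
Qed.

Lemma rat_pabs_ge0 x : 0 <= N x.
Proof. by rewrite /rat_pabs; case: ifP => // _; rewrite divr_ge0 // ltW. Qed.

Lemma rat_pabs1 : N 1 = 1.
Proof.
have {1}-> : 1 = 1%:~R / 1%:~R :> rat by rewrite divr1.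
by rewrite rat_pabs_frac // divff // expf_neq0.
Qed.

Lemma rat_pabsM x y : N (x * y) = N x * N y.
Proof.
have [->|x0] := eqVneq x 0; first by rewrite mul0r rat_pabs0 mul0r.
have [->|y0] := eqVneq y 0; first by rewrite mulr0 rat_pabs0 mulr0.
rewrite -[x in LHS]divq_num_den -[y in LHS]divq_num_den.
rewrite mulrACA -invfM -!rmorphM /= rat_pabs_frac ?mulf_neq0 ?numq_eq0 ?denq_neq0 //.
rewrite !abszM !lognM ?absz_gt0 ?denq_neq0 ?numq_eq0 //.
by rewrite /rat_pabs (negPf x0) (negPf y0) !exprD invfM mulrACA.
Qed.

Lemma rat_pabsN x : N (- x) = N x.
Proof.
by rewrite /rat_pabs oppr_eq0 numqN denqN abszN.
Qed.

Lemma rat_pabsB x y : N (x - y) = N (y - x).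
Proof. by rewrite -rat_pabsN opprB. Qed.

Lemma rat_pabsD x y : N (x + y) <= Num.max (N x) (N y).
Proof.
have [->|x0] := eqVneq x 0.
  by rewrite add0r le_max lexx orbT.
have [->|y0] := eqVneq y 0.
  by rewrite addr0 le_max lexx.
have [->|xy0] := eqVneq (x + y) 0.
  by rewrite rat_pabs0 le_max rat_pabs_ge0.
pose d := denq x * denq y.
pose m := numq x * denq y; pose k := numq y * denq x.
have d0 : d != 0 by rewrite mulf_neq0 ?denq_neq0.
have ex : x = m%:~R / d%:~R.
  rewrite /m /d !rmorphM /= -mulf_div divff ?mulr1 ?divq_num_den //.
  by rewrite intr_eq0 denq_neq0.
have ey : y = k%:~R / d%:~R.
  rewrite /k /d [denq x * _]mulrC !rmorphM /= -mulf_div divff ?mulr1 ?divq_num_den //.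
  by rewrite intr_eq0 denq_neq0.
have exy : x + y = (m + k)%:~R / d%:~R by rewrite rmorphD /= mulrDl -ex -ey.
have m0 : m != 0 by rewrite mulf_neq0 ?numq_eq0 ?denq_neq0.
have k0 : k != 0 by rewrite mulf_neq0 ?numq_eq0 ?denq_neq0.
have mk0 : m + k != 0.
  by apply: contra_neq xy0 => mk0; rewrite exy mk0 mul0r.
rewrite exy ex ey !rat_pabs_frac // le_max !ler_pM2l // !lef_pV2 ?posrE //.
rewrite !ler_eXn2l // -geq_min.
set e := minn _ _.
have em : (Posz (p ^ e)%N %| m)%Z.
  by rewrite dvdzE /= pfactor_dvdn ?absz_gt0 // geq_minl.
have ek : (Posz (p ^ e)%N %| k)%Z.
  by rewrite dvdzE /= pfactor_dvdn ?absz_gt0 // geq_minr.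
have : (Posz (p ^ e)%N %| m + k)%Z by exact: rpredD.
by rewrite dvdzE /= pfactor_dvdn ?absz_gt0.
Qed.

Lemma rat_pabs_bound x y e : N x < e -> N y < e -> N (x + y) < e.
Proof. by move=> xe ye; apply: le_lt_trans (rat_pabsD x y) _; rewrite gt_max xe. Qed.

Lemma rat_pabs_dom x y : N y < N x -> N (x + y) = N x.
Proof.
move=> yx; apply/eqP; rewrite eq_le; apply/andP; split.
  by apply: le_trans (rat_pabsD x y) _; rewrite ge_max lexx ltW.
have := rat_pabsD (x + y) (- y); rewrite addrK rat_pabsN le_max.
by case/orP => // /(lt_le_trans yx); rewrite ltxx.
Qed.
End RatPabs.

Section PadicNumbers.
Variables (p : nat) (p_pr : prime p).
Local Notation N := (rat_pabs p).

Definition padic_cauchy (f : nat -> rat) : Prop :=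
  forall e : rat, 0 < e ->
    exists K : nat, forall m n, (K <= m)%N -> (K <= n)%N -> N (f m - f n) < e.

Definition padic_null (f : nat -> rat) : Prop :=
  forall e : rat, 0 < e ->
    exists K : nat, forall n, (K <= n)%N -> N (f n) < e.

Lemma padic_cauchy_bounded f : padic_cauchy f ->
  exists M K, 0 < M /\ forall n, (K <= n)%N -> N (f n) < M.
Proof.
move=> /(_ 1 ltr01)[K fK]; exists (N (f K) + 1), K; split.
  by rewrite ltr_wpDl // rat_pabs_ge0.
move=> n Kn; rewrite -[f n](subrK (f K)).
apply: (rat_pabs_bound p_pr); last by rewrite ltrDl.
by apply: (lt_le_trans (fK _ _ Kn (leqnn K))); rewrite lerDr rat_pabs_ge0.
Qed.

Lemma padic_cauchy_ev f : padic_cauchy f -> ~ padic_null f ->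
  exists r K, 0 < r /\ forall n, (K <= n)%N -> N (f n) = r.
Proof.
move=> fc /existsNP[e /not_implyP[e0 /forallNP fe]].
have [K fK] := fc e e0.
have /existsNP[m /not_implyP[Km /negP]] := fe K; rewrite -leNgt => efm.
exists (N (f m)), K; split; first exact: lt_le_trans e0 efm.
move=> n Kn; rewrite -[f n](subrK (f m)) addrC.
by apply: (rat_pabs_dom p_pr); apply: lt_le_trans efm; exact: fK.
Qed.

Definition cauchy_pred : {pred (nat -> rat)} := fun f => `[<padic_cauchy f>].

Fact cauchy_subring : subring_closed cauchy_pred.
Proof.
split=> [|f g /asboolP fc /asboolP gc|f g /asboolP fc /asboolP gc].
- by apply/asboolP => e e0; exists 0%N => m n _ _; rewrite subrr rat_pabs0.
- apply/asboolP => e e0; have [K fK] := fc e e0; have [K' gK] := gc e e0.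
  exists (maxn K K') => m n; rewrite !geq_max => /andP[? ?] /andP[? ?].
  rewrite [X in N X](_ : _ = (f m - f n) + (g n - g m)).
    by apply: (rat_pabs_bound p_pr); [exact: fK|exact: gK].
  by rewrite /= !fctE /= opprB addrACA [RHS]addrACA; congr (_ + _); rewrite addrC.
- apply/asboolP => e e0.
  have [M [K1 [M0 fM]]] := padic_cauchy_bounded fc.
  have [L [K2 [L0 gL]]] := padic_cauchy_bounded gc.
  have [K3 fK] := fc (e / L) (divr_gt0 e0 L0).
  have [K4 gK] := gc (e / M) (divr_gt0 e0 M0).
  exists (maxn (maxn K1 K2) (maxn K3 K4)) => m n.
  rewrite !geq_max => /andP[/andP[? ?] /andP[? ?]] /andP[/andP[? ?] /andP[? ?]].
  rewrite [X in N X](_ : _ = f m * (g m - g n) + (f m - f n) * g n); last first.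
    by rewrite mulrBr mulrBl addrA subrK.
  apply: (rat_pabs_bound p_pr); rewrite (rat_pabsM p_pr).
    rewrite -[e](divfK (lt0r_neq0 M0)) mulrC.
    by apply: ltr_pM; rewrite ?rat_pabs_ge0 //; [exact: gK|exact: fM].
  rewrite -[e](divfK (lt0r_neq0 L0)).
  by apply: ltr_pM; rewrite ?rat_pabs_ge0 //; [exact: fK|exact: gL].
Qed.

HB.instance Definition _ :=
  GRing.isSubringClosed.Build (nat -> rat) cauchy_pred cauchy_subring.

Record cauchy_seq := CauchySeq {
  cauchy_val :> nat -> rat ; _ : cauchy_val \in cauchy_pred }.

HB.instance Definition _ := [isSub for cauchy_val].
HB.instance Definition _ := [Choice of cauchy_seq by <:].
HB.instance Definition _ := [SubChoice_isSubComNzRing of cauchy_seq by <:].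

Lemma cauchy_seqP (f : cauchy_seq) : padic_cauchy f.
Proof. by case: f => f /= /asboolP. Qed.

Definition null_pred : {pred cauchy_seq} := fun f => `[<padic_null f>].

Fact null_ideal : idealr_closed null_pred.
Proof.
split.
- by apply/asboolP => e e0; exists 0%N => n _; rewrite /= rat_pabs0.
- apply/asboolP => /(_ 1 ltr01)[K /(_ K (leqnn K))].
  by rewrite /= (rat_pabs1 p_pr) ltxx.
- move=> a u v /asboolP un /asboolP vn; apply/asboolP => e e0.
  have [M [K1 [M0 aM]]] := padic_cauchy_bounded (cauchy_seqP a).
  have [K2 uK] := un (e / M) (divr_gt0 e0 M0); have [K3 vK] := vn e e0.
  exists (maxn K1 (maxn K2 K3)) => n; rewrite !geq_max => /and3P[? ? ?].
  apply: (rat_pabs_bound p_pr); last exact: vK.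
  rewrite (rat_pabsM p_pr) -[e](divfK (lt0r_neq0 M0)) mulrC.
  by apply: ltr_pM; rewrite ?rat_pabs_ge0 //; [exact: uK|exact: aM].
Qed.

HB.instance Definition _ := isIdealr.Build cauchy_seq null_pred null_ideal.

Definition Qp : Type := {ideal_quot null_pred}.
HB.instance Definition _ := GRing.ComNzRing.on Qp.

Definition Qp_of (f : cauchy_seq) : Qp := \pi_({ideal_quot null_pred}) f.

Lemma Qp_of_eq (f g : cauchy_seq) :
  Qp_of f = Qp_of g <-> padic_null (fun n => f n - g n).
Proof.
rewrite /Qp_of; split.
  by move/eqP; rewrite -Quotient.idealrBE => /asboolP.
by move=> fg; apply/eqP; rewrite -Quotient.idealrBE; apply/asboolP.
Qed.

Lemma Qp_of0 : Qp_of 0 = 0.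
Proof. exact: (rmorph0 (\pi_({ideal_quot null_pred}))). Qed.

Lemma Qp_of1 : Qp_of 1 = 1.
Proof. exact: (rmorph1 (\pi_({ideal_quot null_pred}))). Qed.

Lemma Qp_of_eq0 (f : cauchy_seq) : Qp_of f = 0 <-> padic_null f.
Proof.
rewrite -Qp_of0 Qp_of_eq.
by under [X in padic_null X]eq_fun do rewrite subr0.
Qed.

Lemma Qp_ofD f g : Qp_of (f + g) = Qp_of f + Qp_of g.
Proof. exact: (rmorphD (\pi_({ideal_quot null_pred}))). Qed.

Lemma Qp_ofM f g : Qp_of (f * g) = Qp_of f * Qp_of g.
Proof. exact: (rmorphM (\pi_({ideal_quot null_pred}))). Qed.

Lemma Qp_ofP (x : Qp) : exists f, x = Qp_of f.
Proof. by exists (repr x); rewrite /Qp_of reprK. Qed.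

Lemma Qp_caseP (x : Qp) : x = 0 \/
  exists f r K, [/\ x = Qp_of f, 0 < r & forall n, (K <= n)%N -> N (f n) = r].
Proof.
have [f ->] := Qp_ofP x.
have [/Qp_of_eq0|nf] := pselect (padic_null f); [by left|right].
have [r [K [r0 fr]]] := padic_cauchy_ev (cauchy_seqP f) nf.
by exists f, r, K.
Qed.

Lemma Qp_ev_neq0 (f : cauchy_seq) r K : 0 < r ->
  (forall n, (K <= n)%N -> N (f n) = r) -> Qp_of f <> 0.
Proof.
move=> r0 fr /Qp_of_eq0 /(_ r r0)[K' /(_ (maxn K K') (leq_maxr _ _))].
by rewrite fr ?leq_maxl // ltxx.
Qed.

Lemma Qp_has_inv (x : Qp) : x != 0 -> exists y, y * x = 1.
Proof.
case: (Qp_caseP x) => [->|[f [r [K [-> r0 fr]]]] _]; first by rewrite eqxx.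
have fn0 n : (K <= n)%N -> f n != 0.
  by move=> /fr fnr; rewrite -(rat_pabs_eq0 p_pr) fnr gt_eqF.
have gP : (fun n => (f n)^-1) \in cauchy_pred.
  apply/asboolP => e e0.
  have [K' fK'] := cauchy_seqP f (mulr_gt0 e0 (mulr_gt0 r0 r0)).
  exists (maxn K K') => m n; rewrite !geq_max => /andP[Km ?] /andP[Kn ?].
  have -> : (f m)^-1 - (f n)^-1 = (f n - f m) * ((f m)^-1 * (f n)^-1).
    rewrite mulrBl mulrCA divff ?mulr1 ?fn0 //.
    by rewrite mulrA divff ?mul1r ?fn0.
  have inv k : (K <= k)%N -> N (f k)^-1 = r^-1.
    move=> Kk; apply: (mulfI (lt0r_neq0 r0)); rewrite divff ?lt0r_neq0 //.
    by rewrite -{1}(fr k Kk) -(rat_pabsM p_pr) divff ?fn0 // rat_pabs1.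
  rewrite !(rat_pabsM p_pr) !inv // -invfM ltr_pdivrMr ?mulr_gt0 //.
  exact: fK'.
exists (Qp_of (CauchySeq gP)); rewrite -Qp_ofM -Qp_of1; apply/Qp_of_eq.
move=> e e0; exists K => n Kn.
by rewrite /= !fctE /= mulVf ?fn0 // subrr rat_pabs0.
Qed.

Definition Qp_inv (x : Qp) : Qp := xget 0 [set y | y * x = 1].

Fact Qp_mulVf (x : Qp) : x != 0 -> Qp_inv x * x = 1.
Proof.
by move=> /Qp_has_inv[y yx]; rewrite /Qp_inv; case: xgetP => [//|/(_ y)].
Qed.

Fact Qp_inv0 : Qp_inv 0 = 0.
Proof.
rewrite /Qp_inv; case: xgetP => [y _ /=|//].
by rewrite mulr0 => /esym/eqP; rewrite oner_eq0.
Qed.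

HB.instance Definition _ := GRing.ComNzRing_isField.Build Qp Qp_mulVf Qp_inv0.

(* The absolute value of the class of a Cauchy sequence f is lim |f n|_p; the
   limit exists and is rational. *)
Definition Qp_abs (x : Qp) : rat :=
  xget 0 [set r | forall e : rat, 0 < e -> exists K : nat,
    forall n, (K <= n)%N -> `|N (repr x n) - r| < e].

Lemma rat_pabs_dist x y : `|N x - N y| <= N (x - y).
Proof.
wlog yx : x y / N y <= N x.
  move=> H; have [/H//|/ltW/H] := leP (N y) (N x).
  by rewrite distrC (rat_pabsB p y).
rewrite ger0_norm ?subr_ge0 // lerBlDr.
rewrite -[in leLHS](subrK y x); apply: le_trans (rat_pabsD p_pr _ _) _.
by rewrite ge_max lerDl lerDr !rat_pabs_ge0.
Qed.

Lemma Qp_absE (f : cauchy_seq) r :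
  (forall e : rat, 0 < e -> exists K : nat,
    forall n, (K <= n)%N -> `|N (f n) - r| < e) -> Qp_abs (Qp_of f) = r.
Proof.
move=> fr; rewrite /Qp_abs; set g := repr _.
have fg : padic_null (fun n => g n - f n).
  by apply/Qp_of_eq; rewrite /Qp_of /g reprK.
have gr e : 0 < e -> exists K : nat,
    forall n, (K <= n)%N -> `|N (g n) - r| < e.
  move=> e0; have e20 : 0 < e / 2 by rewrite divr_gt0.
  have [K1 fK] := fr _ e20; have [K2 gK] := fg _ e20.
  exists (maxn K1 K2) => n; rewrite geq_max => /andP[? ?].
  apply: le_lt_trans (ler_distD (N (f n)) _ _) _.
  rewrite [ltRHS](splitr e); apply: ltrD; last exact: fK.
  exact: le_lt_trans (rat_pabs_dist _ _) (gK _ _).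
case: xgetP => [s _ /= gs|/(_ r)//].
apply/eqP; rewrite -subr_eq0 -normr_eq0 eq_le normr_ge0 andbT.
rewrite leNgt; apply/negP => d0.
have d20 : 0 < `|s - r| / 2 by rewrite divr_gt0.
have [K1 sK] := gs _ d20; have [K2 rK] := gr _ d20.
have := ltrD (sK _ (leq_maxl K1 K2)) (rK _ (leq_maxr K1 K2)).
rewrite -splitr distrC => /(le_lt_trans (ler_distD _ _ _)).
by rewrite ltxx.
Qed.

Lemma Qp_abs_ev (f : cauchy_seq) r K :
  (forall n, (K <= n)%N -> N (f n) = r) -> Qp_abs (Qp_of f) = r.
Proof.
move=> fr; apply: Qp_absE => e e0; exists K => n Kn.
by rewrite fr // subrr normr0.
Qed.

Lemma Qp_abs0 : Qp_abs 0 = 0.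
Proof.
by rewrite -Qp_of0 (@Qp_abs_ev _ 0 0%N) // => n _; exact: rat_pabs0.
Qed.

Lemma Qp_abs_eq0 x : Qp_abs x = 0 -> x = 0.
Proof.
case: (Qp_caseP x) => [//|[f [r [K [-> r0 fr]]]]].
by rewrite (Qp_abs_ev fr) => re0; rewrite re0 ltxx in r0.
Qed.

Lemma Qp_abs_ge0 x : 0 <= Qp_abs x.
Proof.
case: (Qp_caseP x) => [->|[f [r [K [-> r0 fr]]]]]; first by rewrite Qp_abs0.
by rewrite (Qp_abs_ev fr) ltW.
Qed.

Lemma Qp_absM x y : Qp_abs (x * y) = Qp_abs x * Qp_abs y.
Proof.
case: (Qp_caseP x) => [->|[f [r [K [-> r0 fr]]]]].
  by rewrite mul0r Qp_abs0 mul0r.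
case: (Qp_caseP y) => [->|[g [s [L [-> s0 gs]]]]].
  by rewrite mulr0 Qp_abs0 mulr0.
rewrite (Qp_abs_ev fr) (Qp_abs_ev gs) -Qp_ofM (@Qp_abs_ev _ (r * s) (maxn K L)) //.
move=> n; rewrite geq_max => /andP[? ?].
by rewrite /= (rat_pabsM p_pr) fr // gs.
Qed.

Lemma Qp_absD x y : Qp_abs (x + y) <= Num.max (Qp_abs x) (Qp_abs y).
Proof.
case: (Qp_caseP x) => [->|[f [r [K [-> r0 fr]]]]].
  by rewrite add0r le_max lexx orbT.
case: (Qp_caseP y) => [->|[g [s [L [-> s0 gs]]]]].
  by rewrite addr0 le_max lexx.
rewrite (Qp_abs_ev fr) (Qp_abs_ev gs) -Qp_ofD.
have [/Qp_of_eq0 ->|nfg] := pselect (padic_null (f + g)).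
  by rewrite Qp_abs0 le_max ltW.
have [t [M [t0 fgt]]] := padic_cauchy_ev (cauchy_seqP (f + g)) nfg.
rewrite (@Qp_abs_ev (f + g) t M) //.
pose n := maxn M (maxn K L).
have := rat_pabsD p_pr (f n) (g n).
have [Mn Kn Ln] : [/\ (M <= n)%N, (K <= n)%N & (L <= n)%N].
  by split; rewrite !leq_max leqnn ?orbT.
by rewrite fr // gs // -[f n + g n]/((f + g) n) fgt.
Qed.

Lemma Qp_absN x : Qp_abs (- x) = Qp_abs x.
Proof.
have abs2 (y : Qp) : Qp_abs (- y) ^+ 2 = Qp_abs y ^+ 2.
  by rewrite !expr2 -!Qp_absM mulrNN.
by apply/eqP; rewrite -(@eqrXn2 _ 2) ?Qp_abs_ge0 // abs2.
Qed.

Let dist (x y : Qp) : rat := Qp_abs (x - y).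

Fact Qp_distxx x : dist x x = 0.
Proof. by rewrite /dist subrr Qp_abs0. Qed.

Fact Qp_dist_eq0 x y : dist x y = 0 -> x = y.
Proof. by move=> /Qp_abs_eq0/eqP; rewrite subr_eq0 => /eqP. Qed.

Fact Qp_dist_sym x y : dist x y = dist y x.
Proof. by rewrite /dist -Qp_absN opprB. Qed.

Fact Qp_dist_triangle y x z : dist x z <= dist x y + dist y z.
Proof.
rewrite {1}/dist (_ : x - z = (x - y) + (y - z)); last by rewrite addrA subrK.
apply: le_trans (Qp_absD _ _) _.
by rewrite ge_max lerDl lerDr !Qp_abs_ge0.
Qed.

HB.instance Definition _ :=
  isPointed.Build Qp 0.
HB.instance Definition _ :=
  isMetric.Build rat Qp Qp_distxx Qp_dist_eq0 Qp_dist_sym Qp_dist_triangle.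

End PadicNumbers.

(* Usable for topological spaces with a distinguished point. *)
Notation borel T := (g_sigma_algebraType (@open T)).

Section ProjectiveLine.
Variables (p : nat) (p_pr : prime p).
Local Notation Qp := (Qp p_pr).

(* None is the point at infinity; Qp is locally compact, and the usual topology
   of the projective line is that of its one-point compactification. *)
Definition P1 : Type := one_point_compactification Qp.
HB.instance Definition _ := Topological.on P1.
HB.instance Definition _ := Pointed.on P1.

Definition P1_of : Qp -> P1 := Some.
Definition P1_infty : P1 := None.

Definition moebius (a b c d : Qp) (z : P1) : P1 :=
  if z is Some x then
    if c * x + d == 0 then P1_infty else P1_of ((a * x + b) / (c * x + d))
  else if c == 0 then P1_infty else P1_of (a / c).

Definition P1_inv (z : P1) : P1 :=
  if z is Some x then if x == 0 then P1_infty else P1_of x^-1 else P1_of 0.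

Definition P1_affine (u v : Qp) (z : P1) : P1 :=
  if z is Some x then P1_of (u * x + v) else P1_infty.

Definition Zp : set Qp := [set x | Qp_abs x <= 1].

(* A measure on Zp is represented as a Borel measure on Qp carried by Zp. *)
Definition is_haar_Zp (R : realType) (mu0 : probability (borel Qp) R) : Prop :=
  mu0 Zp = 1%E /\
  forall (x : Qp) (A : set (borel Qp)), Zp x -> measurable A -> A `<=` Zp ->
    mu0 [set x + y | y in A] = mu0 A.

Definition mu_hat (R : realType) (mu0 : probability (borel Qp) R)
    (S : set P1) : \bar R :=
  let S1 := (P1_of @` Zp) `&` S in
  let S2 := ~` (P1_of @` Zp) `&` S in
  ((p%:R / p.+1%:R)%:E *
    (mu0 (P1_of @^-1` S1) + mu0 (P1_of @^-1` (P1_inv @^-1` S2))))%E.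

End ProjectiveLine.

Section TopologicalDynamics.
Variables (T : ptopologicalType) (phi : T -> T).

Definition is_subsystem (B : set T) : Prop :=
  [/\ B !=set0, compact B & phi @` B `<=` B].

Definition is_minimal_subsystem (B : set T) : Prop :=
  is_subsystem B /\
  forall x, B x -> B = closure [set iter n phi x | n in [set: nat]].

(* A Borel probability measure on B is represented as one on T carried by B. *)
Definition is_invariant_measure (B : set T) (R : realType)
    (sigma : probability (borel T) R) : Prop :=
  sigma B = 1%E /\
  forall A : set (borel T), measurable A -> A `<=` B ->
    sigma (B `&` phi @^-1` A) = sigma A.

End TopologicalDynamics.

Section Extensions.
Variables (p : nat) (p_pr : prime p) (L : fieldExtType (Qp p_pr)).
Variables (R : realType) (absL : L -> R).

Definition is_abs_extension : Prop :=
  [/\ forall z, 0 <= absL z,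
      forall z, (absL z == 0) = (z == 0),
      forall z w, absL (z * w) = absL z * absL w,
      forall z w, absL (z + w) <= Num.max (absL z) (absL w) &
      forall x : Qp p_pr, absL x%:A = ratr (Qp_abs x)].

(* Ramification index 1: L and Qp have the same value group. *)
Definition is_unramified : Prop :=
  forall z : L, z != 0 ->
    exists2 x : Qp p_pr, x != 0 & absL z = ratr (Qp_abs x).

End Extensions.

(* Main.v *)
Require Import Defs.
From HB Require Import structures.
From mathcomp Require Import all_boot all_order all_algebra all_field.
From mathcomp Require Import all_classical all_reals all_analysis.
From mathcomp Require Import ring zify.
Set Implicit Arguments.
Unset Strict Implicit.
Unset Printing Implicit Defensive.
Import Order.TTheory GRing.Theory Num.Theory.
Local Open Scope classical_set_scope.
Local Open Scope ring_scope.

(** In the coordinate [z] with [x = h z] the fixed points of [phi] are [w] and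
    [- w], where [w ^ 2 = N] is a unit that is not a square. Read [z = u / v] as
    the line of [u + v * w] in [Qp(w)]: then [phi] becomes multiplication by
    [g = (a + d) / 2 + c * eta * w]. The norm form satisfies
    [|u ^ 2 - N * v ^ 2| = max(|u|, |v|) ^ 2], so [phi] is an isometry of the
    projective distance, and by minimality every invariant measure gives equal mass
    to all balls of a given radius centred in [B]; this determines the measure.
    Some power of [g] is close to [1] and, as [lambda] is not a root of unity, is
    not scalar; its powers are dense in a ball around [1], so [B] is a union of
    balls of a fixed radius. On the integers both charts [z] and [1 / z] are
    isometries, so the image of [mu_hat] under [h] also gives equal mass to small
    balls, and its normalized restriction to [B] is the invariant measure. *)

(** * The p-adic absolute value *)

Section PadicAbs.
Context (p : nat) (p_pr : prime p).
Local Notation N := (rat_pabs p).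
Local Notation Q := (Qp p_pr).
Local Notation abs := (@Qp_abs p p_pr).
Local Notation radius n := (p%:R ^- n : rat).

Lemma prime_natr_gt0 : 0 < p%:R :> rat.
Proof. by rewrite ltr0n prime_gt0. Qed.

Lemma prime_natr_gt1 : 1 < p%:R :> rat.
Proof. by rewrite ltr1n prime_gt1. Qed.

Lemma radius_gt0 n : 0 < radius n.
Proof. by rewrite invr_gt0 exprn_gt0 // prime_natr_gt0. Qed.

Lemma radius_le m n : (radius m <= radius n) = (n <= m)%N.
Proof.
by rewrite lef_pV2 ?posrE ?exprn_gt0 ?prime_natr_gt0 // ler_eXn2l ?prime_natr_gt1.
Qed.

Lemma radiusS_lt n : radius n.+1 < radius n.
Proof. by rewrite ltNge radius_le ltnn. Qed.

Lemma radius_le1 n : radius n <= 1.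
Proof. by have := radius_le n 0; rewrite expr0 invr1 => ->. Qed.

Lemma radius_small (e : rat) : 0 < e -> exists n, radius n < e.
Proof.
move=> e0; have [n ne] : exists n : nat, e^-1 < n%:R.
  exists (Num.truncn e^-1).+1; exact: truncnS_gt.
exists n; rewrite -[ltRHS]invrK ltf_pV2 ?posrE ?invr_gt0 ?exprn_gt0 ?prime_natr_gt0 //.
apply: lt_le_trans ne _; rewrite -natrX ler_nat ltnW //.
by rewrite ltn_expl // prime_gt1.
Qed.

Lemma Qp_absMdiv (x y : Q) : abs (x / y) = abs x / abs y.
Proof.
have [->|y0] := eqVneq y 0; first by rewrite invr0 mulr0 Qp_abs0 invr0 mulr0.
have ay : abs y != 0 by apply: contra_neq y0 => /Qp_abs_eq0.
by apply: (mulIf ay); rewrite -Qp_absM !divfK.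
Qed.

Lemma Qp_abs_neq0 (x : Q) : (abs x == 0) = (x == 0).
Proof.
by apply/eqP/eqP => [/Qp_abs_eq0 //|->]; rewrite Qp_abs0.
Qed.

Lemma Qp_abs_gt0 (x : Q) : (0 < abs x) = (x != 0).
Proof. by rewrite lt_neqAle Qp_abs_ge0 andbT eq_sym Qp_abs_neq0. Qed.

Lemma Qp_absX (x : Q) n : abs (x ^+ n) = abs x ^+ n.
Proof.
elim: n => [|n IH]; last by rewrite !exprS Qp_absM IH.
have := Qp_absM (1 : Q) 1; rewrite mulr1 => e.
have : abs (1 : Q) != 0 by rewrite Qp_abs_neq0 oner_eq0.
by move=> h; apply: (mulIf h); rewrite !expr0 mul1r.
Qed.

Lemma Qp_abs1 : abs 1 = 1.
Proof. by have := Qp_absX 1 0; rewrite !expr0. Qed.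

Lemma Qp_absB_sym (x y : Q) : abs (x - y) = abs (y - x).
Proof. by rewrite -Qp_absN opprB. Qed.

Lemma Qp_absD_le (x y : Q) e : abs x <= e -> abs y <= e -> abs (x + y) <= e.
Proof. by move=> xe ye; apply: le_trans (Qp_absD x y) _; rewrite ge_max xe. Qed.

Lemma Qp_absB_le (x y : Q) e : abs x <= e -> abs y <= e -> abs (x - y) <= e.
Proof. by move=> xe ye; apply: Qp_absD_le; rewrite ?Qp_absN. Qed.

Lemma Qp_absD_dom (x y : Q) : abs y < abs x -> abs (x + y) = abs x.
Proof.
move=> yx; apply/eqP; rewrite eq_le; apply/andP; split.
  by apply: Qp_absD_le => //; exact: ltW.
rewrite leNgt; apply/negP => xyx.
have := Qp_absD (x + y) (- y); rewrite addrK Qp_absN le_max.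
by case/orP => /le_lt_trans; [move=> /(_ _ xyx)|move=> /(_ _ yx)]; rewrite ltxx.
Qed.

(** A Cauchy sequence that is not null has eventually constant absolute value, so a bound on the
    tail is attained by the limit itself. *)
Lemma Qp_abs_lim_le (f : cauchy_seq p) e K : 0 <= e ->
  (forall n, (K <= n)%N -> N (f n) <= e) -> abs (Qp_of p_pr f) <= e.
Proof.
move=> e0 fe; have [/Qp_of_eq0 ->|nf] := pselect (padic_null p f).
  by rewrite Qp_abs0.
have [r [L [r0 fr]]] := padic_cauchy_ev p_pr (cauchy_seqP f) nf.
rewrite (Qp_abs_ev p_pr fr) -(fr (maxn K L)) ?leq_maxr //.
by apply: fe; rewrite leq_maxl.
Qed.

Lemma Qp_abs_value (x : Q) : x != 0 ->
  exists m n, abs x = p%:R ^+ m / p%:R ^+ n.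
Proof.
case: (Qp_caseP x) => [->|[f [r [K [-> r0 fr]]]] _]; first by rewrite eqxx.
rewrite (Qp_abs_ev p_pr fr) -(fr K (leqnn K)) /rat_pabs; case: ifP => [/eqP fK|_].
  by move: r0; rewrite -(fr K (leqnn K)) fK rat_pabs0 ltxx.
by do 2 eexists.
Qed.

Lemma Qp_abs_radius (x : Q) : x != 0 -> abs x <= 1 -> exists n, abs x = radius n.
Proof.
move=> /Qp_abs_value[m [n ->]].
have pm k : 0 < p%:R ^+ k :> rat by rewrite exprn_gt0 // prime_natr_gt0.
rewrite ler_pdivrMr // mul1r ler_eXn2l ?prime_natr_gt1 // => mn.
exists (n - m)%N; rewrite -{1}(subnK mn) exprD invfM mulrCA divff ?mulr1 //.
by rewrite gt_eqF.
Qed.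

(** The nonzero values are integral powers of [p], so none lies strictly between two consecutive
    radii. *)
Lemma Qp_abs_lt_radius (x : Q) n : abs x < radius n -> abs x <= radius n.+1.
Proof.
move=> xn; have [->|x0] := eqVneq x 0; first by rewrite Qp_abs0 ltW // radius_gt0.
have [|m em] := Qp_abs_radius x0; first exact: ltW (lt_le_trans xn (radius_le1 _)).
by move: xn; rewrite em radius_le ltNge radius_le -ltnNge.
Qed.

Lemma Qp_abs_lt1 (x : Q) : abs x < 1 -> abs x <= radius 1.
Proof. by have := @Qp_abs_lt_radius x 0; rewrite expr0 invr1; apply. Qed.

Fact const_cauchy (q : rat) : (fun=> q) \in cauchy_pred p.
Proof.
by apply/asboolP => e e0; exists 0%N => m n _ _; rewrite subrr rat_pabs0.
Qed.

Definition Qp_of_rat (q : rat) : Q := Qp_of p_pr (CauchySeq (const_cauchy q)).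

Lemma Qp_of_rat_abs q : abs (Qp_of_rat q) = N q.
Proof. by apply: (@Qp_abs_ev _ _ _ _ 0%N). Qed.

Lemma Qp_of_rat_nat n : Qp_of_rat n%:R = n%:R.
Proof.
elim: n => [|n IH].
  by rewrite mulr0n; apply: etrans (Qp_of0 p_pr); congr (Qp_of p_pr _); exact: val_inj.
rewrite -[RHS]natr1 -IH -(Qp_of1 p_pr) -Qp_ofD; congr (Qp_of p_pr _); apply: val_inj.
by apply/funext => k /=; rewrite -natr1.
Qed.

Lemma Qp_of_ratB q r : Qp_of_rat (q - r) = Qp_of_rat q - Qp_of_rat r.
Proof.
apply/eqP; rewrite -subr_eq opprK -Qp_ofD; apply/eqP.
by congr (Qp_of p_pr _); apply: val_inj; apply/funext => k /=; rewrite subrK.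
Qed.

Lemma Qp_abs_nat n : abs n%:R = N n%:R.
Proof. by rewrite -Qp_of_rat_nat Qp_of_rat_abs. Qed.

Lemma Qp_abs_natr n : (0 < n)%N -> abs n%:R = radius (logn p n).
Proof.
move=> n0; rewrite Qp_abs_nat; have := @rat_pabs_frac p p_pr n%:Z 1.
rewrite divr1 => -> //; last by rewrite eqz_nat -lt0n.
by rewrite /= logn1 expr0 mul1r.
Qed.

Lemma Qp_abs_nat_le1 n : abs n%:R <= 1.
Proof.
case: n => [|n]; first by rewrite Qp_abs0.
by rewrite Qp_abs_natr // radius_le1.
Qed.

Lemma Qp_abs_prime : abs p%:R = radius 1.
Proof. by rewrite Qp_abs_natr ?prime_gt0 // logn_prime // eqxx. Qed.

Lemma rat_dense (x : Q) e : 0 < e -> exists q, abs (x - Qp_of_rat q) <= e.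
Proof.
move=> e0; have [f ->] := Qp_ofP x; have [K fK] := cauchy_seqP f e0.
have dc : (fun n => f n - f K) \in cauchy_pred p.
  apply/asboolP => e' /(cauchy_seqP f)[L fL]; exists L => m n Lm Ln.
  by rewrite opprB addrA subrK; exact: fL.
exists (f K).
have -> : Qp_of p_pr f = Qp_of p_pr (CauchySeq dc) + Qp_of_rat (f K).
  rewrite -Qp_ofD; congr (Qp_of p_pr _); apply: val_inj; apply/funext => n /=.
  by rewrite subrK.
rewrite addrK.
apply: (@Qp_abs_lim_le _ _ K); first exact: ltW.
by move=> n Kn; apply: ltW; exact: fK.
Qed.

(** The denominator of a [p]-integral rational is invertible modulo [p ^ k], so [q] is congruent to
    a natural number. *)
Lemma rat_residue (q : rat) k : N q <= 1 -> exists i : nat, N (q - i%:R) <= radius k.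
Proof.
have [->|q0] := eqVneq q 0.
  by exists 0%N; rewrite subrr rat_pabs0 ltW // radius_gt0.
move=> Nq.
have ld0 : logn p `|denq q| = 0%N.
  apply/eqP; rewrite -leqn0 leqNgt; apply/negP => ld.
  have pd : (p %| `|denq q|)%N by move: ld; rewrite logn_gt0 mem_primes => /and3P[].
  move: Nq; rewrite /rat_pabs (negPf q0).
  have -> : logn p `|numq q| = 0%N.
    apply: logn_coprime; rewrite prime_coprime //; apply/negP => pn.
    have := coprime_num_den q; rewrite /coprime => /eqP c1.
    have : (p %| gcdn `|numq q| `|denq q|)%N by rewrite dvdn_gcd pn.
    by rewrite c1 dvdn1 => /eqP p1; move: (prime_gt1 p_pr); rewrite p1.
  by rewrite expr0 divr1 leNgt exprn_egt1 ?prime_natr_gt1 // -lt0n ld.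
have pd : coprime (p ^ k) `|denq q|.
  rewrite coprimeXl // prime_coprime //; apply/negP => pd.
  by have := ld0; apply/eqP; rewrite -lt0n logn_gt0 mem_primes p_pr pd absz_gt0 denq_neq0.
(* In this Bezout relation [v] is the inverse of the denominator modulo [p ^ k]; hence the choice of
   [i] below. *)
have [u v uv _] := egcdzP (p ^ k)%N `|denq q|%N.
have guv : u * (p ^ k)%N + v * `|denq q|%N = 1.
  by rewrite uv /gcdz /=; move: pd; rewrite /coprime => /eqP ->.
pose i := `|((v * numq q) %% (p ^ k)%N)%Z|%N.
have pk0 : ((p ^ k)%N : int) != 0 by rewrite eqz_nat -lt0n expn_gt0 prime_gt0.
have iE : (i : int) = ((v * numq q) %% (p ^ k)%N)%Z.
  by rewrite /i gez0_abs // modz_ge0.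
have dE : (`|denq q|%N : int) = denq q by rewrite absz_denq.
exists i.
have -> : q - i%:R = (numq q - i%:Z * denq q)%:~R / (denq q)%:~R.
  rewrite rmorphB rmorphM /= mulrBl mulfK ?intr_eq0 ?denq_neq0 //.
  by rewrite divq_num_den.
set m := numq q - _.
have [->|m0] := eqVneq m 0; first by rewrite mul0r rat_pabs0 ltW ?radius_gt0.
rewrite rat_pabs_frac ?denq_neq0 //.
have pdiv : ((p ^ k)%N %| m)%Z.
  rewrite /m iE; set w := v * numq q.
  rewrite (_ : numq q - _ = u * (p ^ k)%N%:Z * numq q + (w %/ (p ^ k)%N)%Z * (p ^ k)%N * denq q).
    apply: rpredD; last by rewrite mulrAC dvdz_mull.
    by rewrite mulrAC dvdz_mull.
  have -> : (w %% (p ^ k)%N)%Z = w - (w %/ (p ^ k)%N)%Z * (p ^ k)%N.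
    by rewrite {2}(divz_eq w (p ^ k)%N) addrAC subrr add0r.
  rewrite dE in guv.
  transitivity ((u * (p ^ k)%N + v * denq q) * numq q -
    (w - (w %/ (p ^ k)%N)%Z * (p ^ k)%N) * denq q); first by rewrite guv mul1r.
  by rewrite /w; ring.
rewrite ld0 expr0 mul1r radius_le.
by rewrite -pfactor_dvdn ?absz_gt0 // -dvdzE.
Qed.

Lemma Zp_residue (s : Q) k : abs s <= 1 -> exists i : nat, abs (s - i%:R) <= radius k.
Proof.
move=> s1; have [q sq] := rat_dense s (radius_gt0 k).
have [|i qi] := @rat_residue q k.
  rewrite -Qp_of_rat_abs -[Qp_of_rat q](subrK s) Qp_absD_le // Qp_absB_sym.
  exact: le_trans sq (radius_le1 k).
exists i; rewrite -[s](subrK (Qp_of_rat q)) -addrA Qp_absD_le //.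
by rewrite -Qp_of_rat_nat -Qp_of_ratB Qp_of_rat_abs.
Qed.

End PadicAbs.

(** * Completeness, compact balls and square roots in the p-adic numbers *)

Section FieldIdentities.
Context {F : fieldType}.

Lemma affine_inverse_sub (z c v x : F) : c != 0 ->
  z / c + v - x = (z - c * (x - v)) / c.
Proof. by move=> c0; field. Qed.

Lemma newton_sqrt_step (t N : F) : 2 != 0 :> F -> t != 0 ->
  (t - (t ^+ 2 - N) / (2 * t)) ^+ 2 - N = ((t ^+ 2 - N) / (2 * t)) ^+ 2.
Proof. by move=> two0 t0; field; rewrite t0 two0. Qed.

End FieldIdentities.

Section PadicTopology.
Context (p : nat) (p_pr : prime p).
Local Notation Q := (Qp p_pr).
Local Notation abs := (@Qp_abs p p_pr).
Local Notation radius n := (p%:R ^- n : rat).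

Lemma Qp_abs_small0 (x : Q) : (forall n, abs x <= radius n) -> x = 0.
Proof.
move=> xs; apply: Qp_abs_eq0; apply/eqP; rewrite eq_le Qp_abs_ge0 andbT leNgt.
apply/negP => /(radius_small p_pr)[n nx].
by have := lt_le_trans nx (xs n); rewrite ltxx.
Qed.

(** Each [x n] is replaced by a rational within [radius n]. By the ultrametric inequality these
    rationals form a Cauchy sequence, whose class is the limit. *)
Lemma Qp_complete (x : nat -> Q) :
  (forall n, abs (x n.+1 - x n) <= radius n) ->
  exists y, forall n, abs (y - x n) <= radius n.
Proof.
move=> xc.
have xmn n k : abs (x (n + k)%N - x n) <= radius n.
  elim: k => [|k IH]; first by rewrite addn0 subrr Qp_abs0 ltW ?(radius_gt0 p_pr).
  rewrite addnS -[x _.+1](subrK (x (n + k)%N)) -addrA Qp_absD_le //.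
  by apply: le_trans (xc _) _; rewrite (radius_le p_pr) leq_addr.
have /choice[q xq] n := rat_dense (x n) (radius_gt0 p_pr n).
have qmn n m : (n <= m)%N -> abs (Qp_of_rat p_pr (q m) - x n) <= radius n.
  move=> nm; rewrite -[Qp_of_rat _ _](subrK (x m)) -addrA Qp_absD_le //.
    rewrite Qp_absB_sym; apply: le_trans (xq m) _.
    by rewrite (radius_le p_pr).
  by rewrite -(subnKC nm); exact: xmn.
have qc : q \in cauchy_pred p.
  apply/asboolP => e /(radius_small p_pr)[K Ke]; exists K => m n Km Kn.
  apply: le_lt_trans Ke; rewrite -(Qp_of_rat_abs p_pr) Qp_of_ratB.
  have -> : Qp_of_rat p_pr (q m) - Qp_of_rat p_pr (q n)
     = (Qp_of_rat p_pr (q m) - x K) - (Qp_of_rat p_pr (q n) - x K) by ring.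
  by apply: Qp_absB_le; exact: qmn.
exists (Qp_of p_pr (CauchySeq qc)) => n.
have dc : (fun m => q m - q n) \in cauchy_pred p.
  apply/asboolP => e' /(cauchy_seqP (CauchySeq qc))[L fL]; exists L => k m Lk Lm.
  by rewrite opprB addrA subrK; exact: fL.
have -> : Qp_of p_pr (CauchySeq qc) = Qp_of p_pr (CauchySeq dc) + Qp_of_rat p_pr (q n).
  rewrite -Qp_ofD; congr (Qp_of p_pr _); apply: val_inj; apply/funext => k /=.
  by rewrite subrK.
rewrite -addrA Qp_absD_le ?qmn //.
apply: (@Qp_abs_lim_le _ _ _ _ n); first exact/ltW/(radius_gt0 p_pr).
move=> m nm; rewrite /= -(Qp_of_rat_abs p_pr) Qp_of_ratB.
have -> : Qp_of_rat p_pr (q m) - Qp_of_rat p_pr (q n)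
   = (Qp_of_rat p_pr (q m) - x n) - (Qp_of_rat p_pr (q n) - x n) by ring.
by apply: Qp_absB_le; exact: qmn.
Qed.

(** Finitely many representatives suffice modulo [p ^ k]; this is the total boundedness behind
    compactness. *)
Lemma Zp_residue_lt (s : Q) k : abs s <= 1 ->
  exists i : 'I_(p ^ k), abs (s - i%:R) <= radius k.
Proof.
move=> /(Zp_residue k)[i si].
have pk0 : (0 < p ^ k)%N by rewrite expn_gt0 prime_gt0.
exists (Ordinal (ltn_pmod i pk0)) => /=.
rewrite -[s](subrK i%:R) -addrA Qp_absD_le //.
rewrite {1}(divn_eq i (p ^ k)) natrD addrK natrM Qp_absM natrX Qp_absX.
rewrite Qp_abs_prime exprVn expr1 ler_piMl ?Qp_abs_nat_le1 // ltW // (radius_gt0 p_pr).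
Qed.

Lemma Qp_nbhsP (x : Q) (U : set Q) :
  nbhs x U <-> exists n, forall y, abs (x - y) <= radius n -> U y.
Proof.
split=> [/nbhs_ballP[e e0 eU]|[n nU]].
  have [n ne] := radius_small p_pr e0; exists n => y xy; apply: eU.
  by rewrite ballEmdist /=; exact: le_lt_trans xy ne.
apply/nbhs_ballP; exists (radius n); first exact: (radius_gt0 p_pr).
by move=> y; rewrite ballEmdist /= => xy; apply: nU; exact: ltW.
Qed.

(** For each [k] an ultrafilter selects one of the finitely many residue classes of [c * (x - v)]
    modulo [p ^ k]. The selected classes are nested, and completeness gives their common point [z],
    hence the limit [z / c + v]. *)
Lemma Qp_compact_ball (c v : Q) : c != 0 -> compact [set x | abs (c * (x - v)) <= 1].
Proof.
move=> c0; rewrite compact_ultra => F FU FB.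
have /choice[i Fi] k : exists i : nat, F [set x | abs (c * (x - v) - i%:R) <= radius k].
  apply: contrapT => /forallNP nF.
  have /filter_ex[x [/= xB xn]] : F ([set x | abs (c * (x - v)) <= 1] `&`
      [set x | forall i : 'I_(p ^ k), ~ (abs (c * (x - v) - i%:R) <= radius k)]).
    apply: filterI => //; apply: filter_forall => i.
    by have [/nF//|] := in_ultra_setVsetC [set x | abs (c * (x - v) - i%:R) <= radius k] FU.
  by have [i /xn] := Zp_residue_lt k xB.
have [z zi] : exists z, forall n, abs (z - (i n)%:R : Q) <= radius n.
  apply: (@Qp_complete (fun n => (i n)%:R)) => n.
  have /= [x [x1 x2]] := filter_ex (filterI (Fi n) (Fi n.+1)).
  have -> : (i n.+1)%:R - (i n)%:R = (c * (x - v) - (i n)%:R) - (c * (x - v) - (i n.+1)%:R) by ring.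
  apply: Qp_absB_le => //; apply: le_trans x2 _.
  by rewrite (radius_le p_pr).
have Fz k : F [set x | abs (c * (x - v) - z) <= radius k].
  apply: filterS (Fi k) => x /= xi.
  by rewrite -[_ - z](subrKA (i k)%:R) Qp_absD_le // Qp_absB_sym.
exists (z / c + v); split.
  have /= [x [xB xz]] := filter_ex (filterI FB (Fz 0%N)).
  rewrite /= addrK mulrC divfK //.
  have -> : z = c * (x - v) - (c * (x - v) - z) by ring.
  by apply: Qp_absB_le => //; move: xz; rewrite expr0 invr1.
move=> U /Qp_nbhsP[n nU].
have ac0 : 0 < abs c by rewrite Qp_abs_gt0.
have [m mc] := radius_small p_pr (mulr_gt0 ac0 (radius_gt0 p_pr n)).
apply: filterS (Fz m) => x /= xz; apply: nU.
rewrite affine_inverse_sub // Qp_absMdiv ler_pdivrMr // Qp_absB_sym.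
by apply: le_trans xz _; rewrite mulrC; exact: ltW.
Qed.

Lemma Qp_closed_ball (c v : Q) : c != 0 -> closed [set x | abs (c * (x - v)) <= 1].
Proof.
by move=> c0; apply: compact_closed; [exact: metric_hausdorff|exact: Qp_compact_ball].
Qed.

Lemma Qp_abs_2 : (3 <= p)%N -> abs 2 = 1.
Proof.
move=> p3; rewrite Qp_abs_natr // (_ : logn p 2 = 0%N) ?expr0 ?invr1 //.
by apply: logn_coprime; rewrite prime_coprime // gtnNdvd.
Qed.

Lemma Qp_2_neq0 : (3 <= p)%N -> (2 : Q) != 0.
Proof. by move=> p3; rewrite -Qp_abs_neq0 Qp_abs_2 // oner_eq0. Qed.

(** Newton iteration from [s]: since [2] and all iterates are units, each step squares the error.
    The weaker bound [radius n.+1] on the error is enough for convergence. *)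
Lemma Qp_hensel_sqrt (N s : Q) : (3 <= p)%N -> abs s = 1 -> abs (s ^+ 2 - N) < 1 ->
  exists x : Q, x ^+ 2 = N.
Proof.
move=> p3 s1 sN; pose step (t : Q) := t - (t ^+ 2 - N) / (2 * t).
have abs2 := Qp_abs_2 p3; have two0 := Qp_2_neq0 p3.
have st n : abs (iter n step s) = 1 /\ abs (iter n step s ^+ 2 - N) <= radius n.+1.
  elim: n => [|n [t1 tN]] /=; first by split=> //; exact: Qp_abs_lt1.
  set t := iter n step s in t1 tN *.
  have t0 : t != 0 by rewrite -Qp_abs_neq0 t1 oner_eq0.
  have dt : abs ((t ^+ 2 - N) / (2 * t)) <= radius n.+1.
    by rewrite Qp_absMdiv Qp_absM abs2 t1 mulr1 divr1.
  split.
    rewrite /step Qp_absD_dom ?t1 // Qp_absN; apply: le_lt_trans dt _.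
    by apply: lt_le_trans (radiusS_lt p_pr n) _; exact: radius_le1.
  have -> : step t ^+ 2 - N = ((t ^+ 2 - N) / (2 * t)) ^+ 2.
    exact: newton_sqrt_step.
  rewrite Qp_absX expr2.
  apply: le_trans (ler_pM (Qp_abs_ge0 _) (Qp_abs_ge0 _) dt dt) _.
  rewrite -invfM -exprD (radius_le p_pr); lia.
have [|y yn] := @Qp_complete (fun n => iter n step s).
  move=> n /=; have [t1 tN] := st n; set t := iter n step s in t1 tN *.
  rewrite /step addrC addKr Qp_absN Qp_absMdiv Qp_absM abs2 t1 mulr1 divr1.
  by apply: le_trans tN _; rewrite (radius_le p_pr).
exists y; apply/eqP; rewrite -subr_eq0; apply/eqP/Qp_abs_small0 => n.
have [t1 tN] := st n; have := yn n; set t := iter n step s in t1 tN * => yt.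
have -> : y ^+ 2 - N = (y - t) * ((y - t) + (t + t)) + (t ^+ 2 - N) by ring.
apply: Qp_absD_le; last by apply: le_trans tN _; rewrite (radius_le p_pr).
rewrite Qp_absM; apply: le_trans (ler_pM (Qp_abs_ge0 _) (Qp_abs_ge0 _) yt (_ : _ <= 1)) _.
  apply: Qp_absD_le; first exact: le_trans yt (radius_le1 p_pr n).
  by apply: Qp_absD_le; rewrite t1.
by rewrite mulr1.
Qed.

End PadicTopology.

(** * Projective distance on a quadratic extension *)

(* A pair [X] stands for [X.1 + X.2 * w] with [w ^ 2 = N], and also for the
   point [X.1 : X.2] of the projective line. *)
Section QuadraticAlgebra.
Context {F : comNzRingType} (N : F).
Implicit Types X Y Z : F * F.

Definition qmul X Y : F * F :=
  (X.1 * Y.1 + N * X.2 * Y.2, X.1 * Y.2 + X.2 * Y.1).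
Definition qone : F * F := (1, 0).
Definition qconj X : F * F := (X.1, - X.2).
Definition qscale (s : F) X : F * F := (s * X.1, s * X.2).
Definition qpow X n : F * F := iter n (qmul X) qone.
Definition qnorm X : F := X.1 ^+ 2 - N * X.2 ^+ 2.
Definition wedge X Y : F := X.1 * Y.2 - X.2 * Y.1.

Lemma qmulC X Y : qmul X Y = qmul Y X.
Proof. by congr pair; ring. Qed.

Lemma qmulA X Y Z : qmul X (qmul Y Z) = qmul (qmul X Y) Z.
Proof. by congr pair; rewrite /=; ring. Qed.

Lemma qmul1 X : qmul qone X = X.
Proof. by case: X => u v; congr pair; rewrite /=; ring. Qed.

Lemma qmul_conj X : qmul X (qconj X) = (qnorm X, 0).
Proof. by congr pair; rewrite /= /qnorm; ring. Qed.

Lemma qnormM X Y : qnorm (qmul X Y) = qnorm X * qnorm Y.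
Proof. by rewrite /qnorm /=; ring. Qed.

Lemma wedgexx X : wedge X X = 0.
Proof. by rewrite /wedge; ring. Qed.

Lemma wedgeC X Y : wedge X Y = - wedge Y X.
Proof. by rewrite /wedge; ring. Qed.

Lemma wedge_mul X Y Z : wedge (qmul X Z) (qmul Y Z) = wedge X Y * qnorm Z.
Proof. by rewrite /wedge /qnorm /=; ring. Qed.

Lemma wedge_scale s X Y : wedge (qscale s X) Y = s * wedge X Y.
Proof. by rewrite /wedge /=; ring. Qed.

(** Together with [plucker2], this is the source of the ultrametric inequality for the projective
    distance. *)
Lemma plucker1 X Y Z : wedge X Z * Y.1 = wedge X Y * Z.1 + wedge Y Z * X.1.
Proof. by rewrite /wedge; ring. Qed.

Lemma plucker2 X Y Z : wedge X Z * Y.2 = wedge X Y * Z.2 + wedge Y Z * X.2.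
Proof. by rewrite /wedge; ring. Qed.

Lemma qpowD X m n : qpow X (m + n) = qmul (qpow X m) (qpow X n).
Proof.
elim: m => [|m IH]; first by rewrite qmul1.
by rewrite addSn /qpow !iterS -/(qpow _ _) IH qmulA.
Qed.

Lemma qpowM X m n : qpow X (m * n) = qpow (qpow X m) n.
Proof.
elim: n => [|n IH]; first by rewrite muln0.
by rewrite mulnS qpowD IH.
Qed.

End QuadraticAlgebra.

(** The addition law [(s + t) / (1 + N * s * t)] of the tangent, written as [s + t] minus a
    correction: near [1] the slope behaves like a logarithm. *)
Lemma slope_mul (F : fieldType) (N : F) (X Y : F * F) :
  let s := X.2 / X.1 in let t := Y.2 / Y.1 in
  X.1 != 0 -> Y.1 != 0 -> 1 + N * s * t != 0 ->
  (qmul N X Y).2 / (qmul N X Y).1 = s + t - (s + t) * N * s * t / (1 + N * s * t).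
Proof.
case: X Y => [x1 x2] [y1 y2] /= x0 y0.
have -> : 1 + N * (x2 / x1) * (y2 / y1) = (x1 * y1 + N * x2 * y2) / (x1 * y1).
  by field; rewrite x0 y0.
rewrite mulf_eq0 negb_or => /andP[d0 _].
by field; rewrite x0 y0 d0.
Qed.

Section ProjectiveDistance.
Context (p : nat) (p_pr : prime p) (p_ge3 : (3 <= p)%N).
Local Notation Q := (Qp p_pr).
Local Notation abs := (@Qp_abs p p_pr).
Local Notation radius n := (p%:R ^- n : rat).
Context (N : Q) (N_unit : abs N = 1) (N_nonsquare : ~ exists x : Q, x ^+ 2 = N).
Implicit Types X Y Z g h : Q * Q.

(** By [abs_qnorm] and [vabsM] below, this is the absolute value of the quadratic extension, read on
    coordinates. *)
Definition vabs X : rat := Num.max (abs X.1) (abs X.2).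
Definition pdist X Y : rat := abs (wedge X Y) / (vabs X * vabs Y).

Lemma vabs_ge0 X : 0 <= vabs X.
Proof. by rewrite le_max Qp_abs_ge0. Qed.

Lemma vabs_eq0 X : (vabs X == 0) = (X == 0).
Proof.
case: X => u v; apply/eqP/eqP => [e|[-> ->]]; last by rewrite /vabs Qp_abs0 maxxx.
have : abs u <= 0 /\ abs v <= 0 by rewrite -e /vabs /= !le_max !lexx orbT.
case=> u0 v0; congr pair; apply: Qp_abs_eq0; apply/eqP; rewrite eq_le Qp_abs_ge0.
- by rewrite u0.
- by rewrite v0.
Qed.

Lemma vabs_gt0 X : (0 < vabs X) = (X != 0).
Proof. by rewrite lt_neqAle vabs_ge0 andbT eq_sym vabs_eq0. Qed.

Lemma abs1_le_vabs X : abs X.1 <= vabs X. Proof. by rewrite le_max lexx. Qed.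
Lemma abs2_le_vabs X : abs X.2 <= vabs X. Proof. by rewrite le_max lexx orbT. Qed.

Lemma vabs_scale s X : vabs (qscale s X) = abs s * vabs X.
Proof. by rewrite /vabs /= !Qp_absM maxr_pMr // Qp_abs_ge0. Qed.

(** Cancellation is possible only if [|u| = |v|]; then [(u / v) ^ 2] would be congruent to [N]
    modulo [p], and Hensel's lemma would make [N] a square. *)
Lemma abs_qnorm X : abs (qnorm N X) = vabs X ^+ 2.
Proof.
case: X => u v; rewrite /qnorm /vabs /=.
have aNv : abs (N * v ^+ 2) = abs v ^+ 2 by rewrite Qp_absM N_unit mul1r Qp_absX.
have [uv|vu|uv] := ltgtP (abs u) (abs v).
- by rewrite addrC Qp_absD_dom Qp_absN aNv // Qp_absX ltrXn2r ?Qp_abs_ge0.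
- by rewrite Qp_absD_dom ?Qp_absN ?aNv Qp_absX // ltrXn2r ?Qp_abs_ge0.
have [v0|v0] := eqVneq v 0.
  rewrite v0 Qp_abs0 in uv *; rewrite (Qp_abs_eq0 uv).
  by rewrite expr0n /= mulr0 subrr Qp_abs0 expr0n.
have av : abs v != 0 by rewrite Qp_abs_neq0.
have -> : u ^+ 2 - N * v ^+ 2 = ((u / v) ^+ 2 - N) * v ^+ 2.
  by rewrite expr_div_n mulrBl divfK // expf_neq0.
rewrite Qp_absM Qp_absX; suff -> : abs ((u / v) ^+ 2 - N) = 1 by rewrite mul1r uv.
have uv1 : abs (u / v) = 1 by rewrite Qp_absMdiv uv divff.
apply/eqP; rewrite eq_le leNgt; apply/andP; split.
  rewrite -leNgt; apply: Qp_absB_le; last by rewrite N_unit.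
  by rewrite Qp_absX uv1 expr1n.
rewrite leNgt; apply/negP => lt1; apply: N_nonsquare.
exact: Qp_hensel_sqrt p_ge3 uv1 lt1.
Qed.

Lemma vabsM X Y : vabs (qmul N X Y) = vabs X * vabs Y.
Proof.
apply/eqP; rewrite -(@eqrXn2 _ 2) ?mulr_ge0 ?vabs_ge0 //.
by rewrite exprMn -!abs_qnorm qnormM Qp_absM.
Qed.

Lemma vabs1 : vabs (qone : Q * Q) = 1.
Proof. by rewrite /vabs /= Qp_abs1 Qp_abs0 max_l. Qed.

Lemma qmul_neq0 X Y : X != 0 -> Y != 0 -> qmul N X Y != 0.
Proof. by rewrite -!vabs_gt0 vabsM => *; exact: mulr_gt0. Qed.

Lemma qone_neq0 : (qone : Q * Q) != 0.
Proof. by rewrite -vabs_gt0 vabs1. Qed.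

Lemma qpow_neq0 X n : X != 0 -> qpow N X n != 0.
Proof.
move=> X0; elim: n => [|n IH]; first exact: qone_neq0.
exact: qmul_neq0.
Qed.

Lemma vabs_conj X : vabs (qconj X) = vabs X.
Proof. by rewrite /vabs /= Qp_absN. Qed.

Lemma qconj_neq0 X : X != 0 -> qconj X != 0.
Proof. by rewrite -!vabs_gt0 vabs_conj. Qed.

Lemma qnorm_neq0 X : X != 0 -> qnorm N X != 0.
Proof. by move=> X0; rewrite -Qp_abs_neq0 abs_qnorm expf_neq0 // vabs_eq0. Qed.

Lemma pdist_ge0 X Y : 0 <= pdist X Y.
Proof. by rewrite divr_ge0 ?mulr_ge0 ?vabs_ge0 ?Qp_abs_ge0. Qed.

Lemma pdistxx X : pdist X X = 0.
Proof. by rewrite /pdist wedgexx Qp_abs0 mul0r. Qed.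

Lemma pdistC X Y : pdist X Y = pdist Y X.
Proof. by rewrite /pdist wedgeC Qp_absN [vabs X * _]mulrC. Qed.

Lemma pdist_scalel s X Y : s != 0 -> pdist (qscale s X) Y = pdist X Y.
Proof.
move=> s0; have as0 : abs s != 0 by rewrite Qp_abs_neq0.
by rewrite /pdist wedge_scale vabs_scale Qp_absM -[_ * vabs Y]mulrA -mulf_div divff // mul1r.
Qed.

Lemma pdist_scaler s X Y : s != 0 -> pdist X (qscale s Y) = pdist X Y.
Proof. by move=> s0; rewrite pdistC pdist_scalel // pdistC. Qed.

(** After multiplication by [vabs Y], which is [|Y.1|] or [|Y.2|], the corresponding Plucker
    relation bounds the wedge of [X] and [Z]. *)
Lemma pdist_ultra Y X Z (e : rat) : X != 0 -> Y != 0 -> Z != 0 ->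
  pdist X Y <= e -> pdist Y Z <= e -> pdist X Z <= e.
Proof.
rewrite -!vabs_gt0 => X0 Y0 Z0.
rewrite /pdist !ler_pdivrMr ?mulr_gt0 // => XY YZ.
rewrite -(ler_pM2r Y0).
have key a b : a <= vabs Z -> b <= vabs X -> 0 <= a -> 0 <= b ->
    abs (wedge X Y) * a <= e * (vabs X * vabs Z) * vabs Y /\
    abs (wedge Y Z) * b <= e * (vabs X * vabs Z) * vabs Y.
  move=> aZ bX a0 b0; split.
    apply: le_trans (ler_pM (Qp_abs_ge0 _) a0 XY aZ) _.
    by rewrite (_ : e * (vabs X * vabs Z) * vabs Y = e * (vabs X * vabs Y) * vabs Z) //; ring.
  apply: le_trans (ler_pM (Qp_abs_ge0 _) b0 YZ bX) _.
  by rewrite (_ : e * (vabs X * vabs Z) * vabs Y = e * (vabs Y * vabs Z) * vabs X) //; ring.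
have [eY|eY] : vabs Y = abs Y.1 \/ vabs Y = abs Y.2.
  by rewrite /vabs; case: leP; [right|left].
- have [k1 k2] := key _ _ (abs1_le_vabs Z) (abs1_le_vabs X) (Qp_abs_ge0 _) (Qp_abs_ge0 _).
  by rewrite {1}eY -Qp_absM plucker1 Qp_absD_le // Qp_absM.
- have [k1 k2] := key _ _ (abs2_le_vabs Z) (abs2_le_vabs X) (Qp_abs_ge0 _) (Qp_abs_ge0 _).
  by rewrite {1}eY -Qp_absM plucker2 Qp_absD_le // Qp_absM.
Qed.

(** The wedge is multiplied by the norm of [Z], whose absolute value [vabs Z ^ 2] is also the factor
    gained by the denominator. *)
Lemma pdist_mulr X Y Z : Z != 0 -> pdist (qmul N X Z) (qmul N Y Z) = pdist X Y.
Proof.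
move=> Z0; have vZ : vabs Z != 0 by rewrite vabs_eq0.
rewrite /pdist wedge_mul !vabsM Qp_absM abs_qnorm.
by rewrite mulrACA -expr2 -mulf_div divff ?mulr1 ?expf_neq0.
Qed.

Lemma pdist_mull g X Y : g != 0 -> pdist (qmul N g X) (qmul N g Y) = pdist X Y.
Proof. by move=> g0; rewrite ![qmul N g _]qmulC pdist_mulr. Qed.

Lemma pdist_one X : pdist qone X = abs X.2 / vabs X.
Proof. by rewrite /pdist vabs1 mul1r /wedge /= mul1r mul0r subr0. Qed.

Lemma pdist_one_lt1 X : X != 0 -> pdist qone X < 1 -> vabs X = abs X.1 /\ X.1 != 0.
Proof.
rewrite -vabs_gt0 pdist_one => vX0; rewrite ltr_pdivrMr // mul1r => X2.
have e : vabs X = abs X.1.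
  apply: max_l; rewrite leNgt; apply/negP => X12.
  by move: X2; rewrite /vabs max_r ?ltxx // ltW.
by split=> //; rewrite -Qp_abs_neq0 -e gt_eqF.
Qed.

Lemma pdist_slope X : X != 0 -> pdist qone X < 1 -> pdist qone X = abs (X.2 / X.1).
Proof. by move=> X0 /(pdist_one_lt1 X0)[e _]; rewrite pdist_one e Qp_absMdiv. Qed.

Lemma pdist_slopeB X Y : X != 0 -> Y != 0 -> pdist qone X < 1 -> pdist qone Y < 1 ->
  pdist X Y = abs (X.2 / X.1 - Y.2 / Y.1).
Proof.
move=> X0 Y0 /(pdist_one_lt1 X0)[eX X1] /(pdist_one_lt1 Y0)[eY Y1].
rewrite /pdist eX eY -Qp_absM -Qp_absMdiv Qp_absB_sym; congr (abs _).
by rewrite /wedge mulrBl -!mulf_div divff // mul1r divff // mulr1.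
Qed.

Lemma pdist_one_mul g h e : g != 0 -> h != 0 ->
  pdist qone g <= e -> pdist qone h <= e -> pdist qone (qmul N g h) <= e.
Proof.
move=> g0 h0 ge he; apply: (@pdist_ultra g) => //.
- exact: qone_neq0.
- exact: qmul_neq0.
- have -> : pdist g (qmul N g h) = pdist qone h; last by [].
  by rewrite -[X in pdist X _](qmul1 N) qmulC pdist_mull.
Qed.

Lemma pdist_one_pow g n : g != 0 -> pdist qone (qpow N g n) <= pdist qone g.
Proof.
move=> g0; elim: n => [|n IH]; first by rewrite pdistxx pdist_ge0.
by apply: pdist_one_mul => //; exact: qpow_neq0.
Qed.

(** In each application of the addition law the denominator is a unit, and the correction contains
    the three factors [s], [s + t] and [t]. The first has absolute value [pdist qone g]; the other
    two contribute at most [radius 1] each. *)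
Lemma slope_pow g n : g != 0 -> pdist qone g < 1 ->
  abs ((qpow N g n).2 / (qpow N g n).1 - n%:R * (g.2 / g.1)) <= pdist qone g * radius 2.
Proof.
move=> g0 g1; have rg : pdist qone g <= radius 1.
  by rewrite pdist_slope // Qp_abs_lt1 // -pdist_slope.
have d0 := pdist_ge0 qone g.
elim: n => [|n IH].
  by rewrite /= !mul0r subrr Qp_abs0 mulr_ge0 // ltW // (radius_gt0 p_pr).
set h := qpow N g n in IH *; rewrite /qpow iterS -/(qpow N g n) -/h.
have h0 : h != 0 by exact: qpow_neq0.
have hg : pdist qone h <= pdist qone g by exact: pdist_one_pow.
have h1 := le_lt_trans hg g1.
have [_ g10] := pdist_one_lt1 g0 g1; have [_ h10] := pdist_one_lt1 h0 h1.
set s := g.2 / g.1 in IH *; set t := h.2 / h.1 in IH *.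
have es : abs s = pdist qone g by rewrite pdist_slope.
have et : abs t <= pdist qone g by rewrite -pdist_slope.
have st1 : abs (N * s * t) < 1.
  rewrite Qp_absM [abs (N * s)]Qp_absM N_unit mul1r es; apply: le_lt_trans (g1).
  by rewrite ler_piMr // (le_trans et) // ltW.
have den : abs (1 + N * s * t) = 1 by rewrite Qp_absD_dom Qp_abs1.
have den0 : 1 + N * s * t != 0 by rewrite -Qp_abs_neq0 den oner_eq0.
rewrite slope_mul // -/s -/t.
have -> : s + t - (s + t) * N * s * t / (1 + N * s * t) - n.+1%:R * s =
  (t - n%:R * s) - (s + t) * N * s * t / (1 + N * s * t).
  by rewrite -natr1; ring.
apply: Qp_absB_le => //.
have absM4 a b c : abs (a * N * b * c) = abs b * (abs a * abs c).
  by rewrite !Qp_absM N_unit mulr1; ring.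
rewrite Qp_absMdiv den divr1 absM4 es.
have st : abs (s + t) <= pdist qone g by rewrite Qp_absD_le // es.
apply: ler_pM => //; first by rewrite mulr_ge0 ?Qp_abs_ge0.
have -> : radius 2 = radius 1 * radius 1 by rewrite -invfM -exprD.
apply: ler_pM; rewrite ?Qp_abs_ge0 //; [exact: le_trans st rg|exact: le_trans et rg].
Qed.

(** The main term [p * s] of the slope of [g ^ p] strictly dominates the error of [slope_pow]. *)
Lemma pdist_one_pow_prime g : g != 0 -> 0 < pdist qone g < 1 ->
  pdist qone (qpow N g p) = pdist qone g * radius 1.
Proof.
move=> g0 /andP[gp g1]; have := slope_pow p g0 g1.
set s := g.2 / g.1; set t := _ / _ => ts.
have ps : abs (p%:R * s) = pdist qone g * radius 1.
  by rewrite Qp_absM Qp_abs_prime mulrC -pdist_slope.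
rewrite pdist_slope ?qpow_neq0 //; last exact: le_lt_trans (pdist_one_pow _ g0) g1.
rewrite -/t -ps -[t](subrK (p%:R * s)) addrC Qp_absD_dom // ps.
by apply: le_lt_trans ts _; rewrite ltr_pM2l // (radiusS_lt p_pr).
Qed.

(* The digit expansion of [slope A / slope g] is found one digit at a time:
   after multiplication by a power of [g], the remaining factor of [A] is as
   close to [1] as [g ^ p] is. *)
Lemma qpow_dense n g A : g != 0 -> A != 0 -> 0 < pdist qone g < 1 ->
  pdist qone A <= pdist qone g ->
  exists j, pdist (qpow N g j) A <= pdist qone g * radius n.
Proof.
elim: n g A => [|n IH] g A g0 A0 g01 Ag.
  by exists 0%N; rewrite expr0 invr1 mulr1.
have /andP[gp g1] := g01; have A1 := le_lt_trans Ag g1.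
have s0 : g.2 / g.1 != 0 by rewrite -Qp_abs_gt0 -pdist_slope.
(* [i] represents the first digit of the quotient of the slopes, which is a p-adic integer because
   [A] is no farther from [1] than [g]. *)
have [|i ir] := @Zp_residue _ p_pr ((A.2 / A.1) / (g.2 / g.1)) 1.
  by rewrite Qp_absMdiv -!pdist_slope // ler_pdivrMr // mul1r.
have gi0 := qpow_neq0 i g0.
have gi1 := le_lt_trans (pdist_one_pow i g0) g1.
have giA : pdist (qpow N g i) A <= pdist qone g * radius 1.
  rewrite pdist_slopeB //.
  rewrite -[_ - A.2 / A.1](subrKA (i%:R * (g.2 / g.1))) Qp_absD_le //.
    apply: le_trans (slope_pow i g0 g1) _.
    by rewrite ler_pM2l // ltW // (radiusS_lt p_pr).
  have -> : i%:R * (g.2 / g.1) - A.2 / A.1 =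
      (i%:R - (A.2 / A.1) / (g.2 / g.1)) * (g.2 / g.1) by rewrite mulrBl divfK.
  by rewrite Qp_absM mulrC Qp_absB_sym -pdist_slope // ler_pM2l.
(* Up to the scalar norm of [g ^ i], invisible to [pdist], this is the quotient of [A] by
   [g ^ i]. *)
pose A' := qmul N (qconj (qpow N g i)) A.
have nz := qnorm_neq0 gi0.
have giA' : qmul N (qpow N g i) A' = qscale (qnorm N (qpow N g i)) A.
  by rewrite /A' qmulA qmul_conj /qmul /qscale /= !mulr0 !mul0r !addr0.
have distA' X : pdist X A' = pdist (qmul N (qpow N g i) X) A.
  by rewrite -[RHS](pdist_scaler _ _ nz) -giA' pdist_mull.
have A'0 : A' != 0 by rewrite qmul_neq0 // qconj_neq0.
have gp0 := qpow_neq0 p g0.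
have egp := pdist_one_pow_prime g0 g01.
have gpp : pdist qone (qpow N g p) <= pdist qone g by exact: pdist_one_pow.
have [||j jn] := IH (qpow N g p) A' gp0 A'0.
- by rewrite (le_lt_trans gpp) // egp mulr_gt0 // (radius_gt0 p_pr).
- by rewrite egp distA' qmulC qmul1.
exists (i + p * j)%N; rewrite qpowD qpowM -distA'.
by apply: le_trans jn _; rewrite egp -mulrA -invfM -exprD add1n.
Qed.

End ProjectiveDistance.

(** * Unique ergodicity of minimal systems preserving a nested family of balls *)

Section BorelMeasures.

Lemma open_borel_measurable (T : ptopologicalType) (U : set T) :
  open U -> measurable (U : set (borel T)).
Proof. by move=> oU; apply: sub_sigma_algebra. Qed.

Lemma continuous_borel_measurable_fun (S T : ptopologicalType) (f : S -> T) :
  continuous f -> measurable_fun setT (f : borel S -> borel T).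
Proof.
move=> cf; apply: (@measurability _ _ (borel S) (borel T) setT f (@open T)) => // _ [U oU <-].
by rewrite setTI; apply: open_borel_measurable; apply: open_comp oU => x _; exact: cf.
Qed.

Lemma pushforward_probability (R : realType) (S T : ptopologicalType)
    (P : probability (borel S) R) (f : S -> T) : continuous f ->
  exists Q : probability (borel T) R, forall A, Q A = P (f @^-1` A).
Proof.
move=> /continuous_borel_measurable_fun mf.
by exists (distribution P (mfun_Sub (mem_set mf))).
Qed.

End BorelMeasures.

Section UltrametricBalls.
(** The balls are the classes of a decreasing sequence of equivalence relations. No radii are
    recorded, so that the numbering can be shifted in the application. *)
Context (T : ptopologicalType) (D : nat -> T -> set T).
Hypothesis D_refl : forall n x, D n x x.
Hypothesis D_eq : forall n x y, D n x y -> D n x = D n y.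
Hypothesis D_anti : forall n x, D n.+1 x `<=` D n x.
Hypothesis D_nbhs : forall x (U : set T), nbhs x U <-> exists n, D n x `<=` U.

Lemma ball_anti m n x : (m <= n)%N -> D n x `<=` D m x.
Proof.
move=> /subnKC <-; elim: (n - m)%N => [|k IH]; first by rewrite addn0.
by rewrite addnS; apply: subset_trans IH; exact: D_anti.
Qed.

Lemma saturated_open n (V : set T) : (forall y, V y -> D n y `<=` V) -> open V.
Proof. by move=> sV; rewrite openE => y Vy; apply/D_nbhs; exists n; exact: sV. Qed.

Lemma ball_open n x : open (D n x).
Proof. by apply: (@saturated_open n) => y /D_eq ->. Qed.

Lemma ball_measurable n x : measurable (D n x : set (borel T)).
Proof. by apply: open_borel_measurable; exact: ball_open. Qed.

Lemma closure_ballP (A : set T) y :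
  closure A y <-> forall n, exists z, A z /\ D n y z.
Proof.
split=> [clA n|nA U /D_nbhs[n nU]].
  by have [|z [Az Dz]] := clA (D n y); [apply/D_nbhs; exists n|exists z].
by have [z [Az Dz]] := nA n; exists z; split=> //; exact: nU.
Qed.

Section BallConstantMeasures.
Context (R : realType) (B : set T) (x : nat -> T).
Hypothesis mB : measurable (B : set (borel T)).
Hypothesis xB : forall i, B (x i).
Hypothesis x_dense : forall n y, B y -> exists i, D n y (x i).

(** Two balls of the same index are equal or disjoint, so removing the earlier balls leaves either
    the whole ball or nothing: [piece n] lists each ball once. *)
Let piece n := seqDU (fun i => D n (x i)).

Lemma piece_ball n i : piece n i = D n (x i) \/ piece n i = set0.
Proof.
have -> : piece n i = D n (x i) `\` \bigcup_(k < i) D n (x k) by rewrite bigcup_mkord.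
have [[j [ji Dj]]|nj] := pselect (exists j, (j < i)%N /\ D n (x j) (x i)).
  right; rewrite -subset0 => y [Dy nDy]; apply: nDy.
  by exists j => //=; rewrite (D_eq Dj).
left; apply/seteqP; split=> [y []//|y Dy]; split=> // -[j /= ji Djy].
by apply: nj; exists j; split=> //; rewrite (D_eq Djy) -(D_eq Dy); exact: D_refl.
Qed.

(** By density of the sequence [x], the pieces cover [B]; what they miss is null. *)
Lemma saturated_measure (m : {measure set (borel T) -> \bar R}) n (V : set T) :
  m (~` B) = 0%E -> (forall y, V y -> D n y `<=` V) ->
  m V = (\sum_(0 <= i <oo) m (V `&` piece n i))%E.
Proof.
move=> mB0 sV.
have mV : measurable (V : set (borel T)).
  by apply: open_borel_measurable; exact: saturated_open sV.
have mp i : measurable (piece n i : set (borel T)).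
  by case: (piece_ball n i) => ->; [exact: ball_measurable|exact: measurable0].
have mVp i : measurable (V `&` piece n i : set (borel T)) by exact: measurableI.
rewrite -(measure_semi_bigcup m mVp); first last.
- exact: bigcup_measurable.
- by apply: trivIset_setIl; exact: trivIset_seqDU.
have mU : measurable (\bigcup_i (V `&` piece n i) : set (borel T)).
  exact: bigcup_measurable.
rewrite -(@measureU0 _ _ _ m _ (V `\` \bigcup_i (V `&` piece n i)) mU).
- rewrite setDUK // => y [i _ [Vy _]] //.
- exact: measurableD.
apply: (subset_measure0 _ _ _ mB0); [exact: measurableD|exact: measurableC|].
move=> y [Vy nVy] By; apply: nVy; rewrite -setI_bigcupr; split=> //.
rewrite -seqDU_bigcup_eq; have [i Dyi] := x_dense n By.
by exists i => //; rewrite -(D_eq Dyi); exact: D_refl.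
Qed.

(** The common mass of the balls of index [n] is fixed by the total mass [1], so the measures agree
    on unions of such balls. Every open set is an increasing union of these, and the open sets are a
    generating class stable under intersection. *)
Lemma ball_constant_unique (m1 m2 : probability (borel T) R) :
  m1 B = 1%E -> m2 B = 1%E ->
  (forall n y z, B y -> B z -> m1 (D n y) = m1 (D n z)) ->
  (forall n y z, B y -> B z -> m2 (D n y) = m2 (D n z)) ->
  forall A : set (borel T), measurable A -> m1 A = m2 A.
Proof.
move=> m1B m2B c1 c2.
have B0 (m : probability (borel T) R) : m B = 1%E -> m (~` B) = 0%E.
  by move=> mB1; rewrite probability_setC // mB1 subee.
have mball (m : probability (borel T) R) n :
    (forall n y z, B y -> B z -> m (D n y) = m (D n z)) ->
    forall i, m (piece n i) = ((fine (m (D n (x 0%N))))%:E * (piece n i != set0)%:R%:E)%E.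
  move=> mc i; rewrite fineK ?fin_num_measure //; last exact: ball_measurable.
  have [->|] := piece_ball n i; last by move=> ->; rewrite measure0 eqxx mule0.
  rewrite (_ : D n (x i) != set0) ?mule1; first exact: mc.
  by apply/set0P; exists (x i); exact: D_refl.
have eqc n : m1 (D n (x 0%N)) = m2 (D n (x 0%N)).
  (* [E] counts the distinct balls of index [n] in the list. *)
  pose E := (\sum_(0 <= i <oo) (piece n i != set0)%:R%:E)%E : \bar R.
  have cE (m : probability (borel T) R) : m B = 1%E ->
      (forall n y z, B y -> B z -> m (D n y) = m (D n z)) ->
      (m (D n (x 0%N)) * E = 1)%E.
    move=> mB1 mc; rewrite -(@probability_setT _ _ _ m).
    rewrite (saturated_measure (B0 _ mB1) (fun y _ => @subsetT _ (D n y))).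
    apply/esym; transitivity (\sum_(0 <= i <oo)
        ((fine (m (D n (x 0%N))))%:E * (piece n i != set0)%:R%:E))%E.
      by apply: eq_eseriesr => i _; rewrite setTI; exact: mball.
    by rewrite nneseriesZl // fineK // ?fin_num_measure //; exact: ball_measurable.
  (* With [m1 D * E = 1] and [m2 D * E = 1], write [m1 D = m1 D * (m2 D * E) = m2 D * (m1 D * E) =
     m2 D]; no division by [E] occurs. *)
  rewrite -[LHS]mule1 -(cE m2 m2B c2) muleCA (cE m1 m1B c1) mule1 //.
have eqV n (V : set T) : (forall y, V y -> D n y `<=` V) -> m1 V = m2 V.
  move=> sV; rewrite (saturated_measure (B0 _ m1B) sV) (saturated_measure (B0 _ m2B) sV).
  apply: eq_eseriesr => i _; have [->|->] := piece_ball n i; last by rewrite setI0 !measure0.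
  have [Vx|nVx] := pselect (V (x i)).
    rewrite (setIidr (sV _ Vx)).
    exact: etrans (c1 n _ _ (xB i) (xB 0%N)) (etrans (eqc n) (c2 n _ _ (xB 0%N) (xB i))).
  rewrite (_ : V `&` _ = set0) ?measure0 // -subset0 => y [Vy Dy].
  by apply: nVx; apply: (sV y Vy); rewrite -(D_eq Dy); exact: D_refl.
apply: (@measure_unique _ R (borel T) (@open T) (fun=> setT)).
- by [].
- by move=> U V; exact: openI.
- by move=> _; exact: openT.
- by rewrite bigcup_const //; exists 0%N.
(* [Un n] is the largest union of balls of index [n] inside [U]. *)
- move=> U oU; pose Un n := [set y | D n y `<=` U].
  have sUn n y : Un n y -> D n y `<=` Un n.
    by move=> yU z /D_eq Dz; rewrite /Un /= -Dz.
  have mUn n : measurable (Un n : set (borel T)).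
    by apply: open_borel_measurable; exact: saturated_open (@sUn n).
  have -> : U = \bigcup_n Un n.
    apply/seteqP; split=> [y Uy|y [n _]]; last by apply; exact: D_refl.
    have /D_nbhs[n nU] : nbhs y U by move: oU; rewrite openE; exact.
    by exists n.
  have ndU : nondecreasing_seq Un.
    move=> m n mn; apply/subsetPset => y; apply: subset_trans; exact: ball_anti.
  have mU : measurable (\bigcup_n Un n : set (borel T)) by exact: bigcup_measurable.
  have c_m1 := nondecreasing_cvg_mu (mu := m1) mUn mU ndU.
  have c_m2 := nondecreasing_cvg_mu (mu := m2) mUn mU ndU.
  have e12 : m1 \o Un = m2 \o Un by apply/funext => n /=; exact: eqV (@sUn n).
  rewrite e12 in c_m1; exact: (cvg_unique _ c_m1 c_m2).
- by move=> _; rewrite -ge0_fin_numE // fin_num_measure.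
Qed.

End BallConstantMeasures.

(** * Invariant measures of a minimal isometry *)

Section MinimalIsometry.
Context (phi : T -> T) (B : set T).
Hypothesis phi_ball : forall n y, phi @^-1` D n (phi y) = D n y.
Hypothesis phi_minimal : is_minimal_subsystem phi B.

Lemma ball_preserving_continuous : continuous phi.
Proof.
move=> y U /D_nbhs[n nU]; apply/D_nbhs; exists n => z.
by rewrite -phi_ball => /nU.
Qed.

Lemma minimal_phi y : B y -> B (phi y).
Proof. by move=> By; case: phi_minimal => [[_ _ +] _]; apply; exists y. Qed.

Lemma minimal_iter k y : B y -> B (iter k phi y).
Proof. by move=> By; elim: k => //= k; exact: minimal_phi. Qed.

Lemma minimal_dense n y z : B y -> B z -> exists k, D n z (iter k phi y).
Proof.
move=> By; have -> := phi_minimal.2 _ By.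
by move/closure_ballP/(_ n) => [_ [[k _ <-] Dk]]; exists k.
Qed.

Lemma minimal_closed : closed B.
Proof.
have [y By] : B !=set0 by case: phi_minimal => [[]].
by rewrite (phi_minimal.2 _ By); exact: closed_closure.
Qed.

Lemma minimal_measurable : measurable (B : set (borel T)).
Proof.
rewrite -[B]setCK; apply: measurableC; apply: open_borel_measurable.
exact/closed_openC/minimal_closed.
Qed.

Context (R : realType).
Implicit Types sigma tau : probability (borel T) R.

Lemma minimal_ball_constant_unique sigma tau :
  sigma B = 1%E -> tau B = 1%E ->
  (forall n y z, B y -> B z -> sigma (D n y) = sigma (D n z)) ->
  (forall n y z, B y -> B z -> tau (D n y) = tau (D n z)) ->
  forall A : set (borel T), measurable A -> sigma A = tau A.
Proof.
have [x Bx] : B !=set0 by case: phi_minimal => [[]].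
apply: (@ball_constant_unique _ _ (fun k => iter k phi x)).
- exact: minimal_measurable.
- by move=> i; exact: minimal_iter.
- by move=> n y By; exact: minimal_dense.
Qed.

Lemma setI_full_probability sigma (A : set (borel T)) :
  sigma B = 1%E -> measurable A -> sigma (A `&` B) = sigma A.
Proof.
move=> sB mA; have mB := minimal_measurable.
rewrite [RHS](measureDI sigma mA mB) [X in (X + _)%E](_ : _ = 0%E) ?add0e //.
have sC0 : sigma (~` B) = 0%E by rewrite probability_setC // sB subee.
apply: (subset_measure0 _ _ _ sC0); [exact: measurableD|exact: measurableC|].
by move=> y [].
Qed.

(** The preimage of the ball at [phi y] is the ball at [y], so invariance makes the mass constant
    along an orbit; each orbit meets every ball centred in [B]. *)
Lemma invariant_ball_constant tau : is_invariant_measure phi B tau ->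
  forall n y z, B y -> B z -> tau (D n y) = tau (D n z).
Proof.
move=> [tB tinv] n; have mB := minimal_measurable.
have step y : B y -> tau (D n (phi y)) = tau (D n y).
  move=> By; rewrite -(@setI_full_probability tau (D n (phi y))) //; last exact: ball_measurable.
  rewrite -(@setI_full_probability tau (D n y)) //; last exact: ball_measurable.
  rewrite -tinv; [|by apply: measurableI => //; exact: ball_measurable|by move=> ? []].
  congr (tau _); rewrite preimage_setI phi_ball setIC -setIA; congr (_ `&` _).
  by apply/seteqP; split=> [? []//|z Bz]; split=> //; exact: minimal_phi.
have steps y k : B y -> tau (D n (iter k phi y)) = tau (D n y).
  by move=> By; elim: k => //= k <-; apply: step; exact: minimal_iter.
move=> y z By Bz; have [k Dk] := minimal_dense n By Bz.
by rewrite (D_eq Dk) steps.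
Qed.

(** The image of [sigma] under [phi] also gives equal mass to balls of equal index, so uniqueness
    identifies it with [sigma]. *)
Lemma ball_constant_invariant sigma : sigma B = 1%E ->
  (forall n y z, B y -> B z -> sigma (D n y) = sigma (D n z)) ->
  is_invariant_measure phi B sigma.
Proof.
move=> sB sc; split=> // A mA AB; have mB := minimal_measurable.
have [tau tauE] := pushforward_probability sigma ball_preserving_continuous.
have mphi (C : set (borel T)) : measurable C -> measurable (phi @^-1` C : set (borel T)).
  by move=> mC; rewrite -[_ @^-1` _]setTI;
    exact: continuous_borel_measurable_fun ball_preserving_continuous _ _ mC.
rewrite setIC setI_full_probability //; last exact: mphi.
rewrite -tauE; apply/esym; apply: minimal_ball_constant_unique => //.
- rewrite tauE -(@setI_full_probability sigma) //; last exact: mphi.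
  rewrite (_ : _ `&` B = B) //.
  by apply/seteqP; split=> [? []//|z Bz]; split=> //; exact: minimal_phi.
move=> n; suff H y : B y -> tau (D n y) = sigma (D n y).
  by move=> y z By Bz; rewrite !H //; exact: sc.
(* The orbit is started at [phi y] so that the point close to [y] has the form [phi (iter k phi y)];
   the preimage of the ball is then a ball centred in [B]. *)
move=> By; have [k] := minimal_dense n (minimal_phi By) By.
rewrite -iterSr iterS => Dk; rewrite tauE (D_eq Dk) phi_ball.
by apply: sc; [exact: minimal_iter|apply: minimal_phi; exact: minimal_iter].
Qed.

End MinimalIsometry.

End UltrametricBalls.

(** * The projective line in the coordinate of the fixed points *)

(* [hcoord x] are homogeneous coordinates of [h^-1 x], where [h z = eta * z + v0]. *)
Section ProjectiveBalls.
Context (p : nat) (p_pr : prime p).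
Local Notation Q := (Qp p_pr).
Local Notation abs := (@Qp_abs p p_pr).
Local Notation radius n := (p%:R ^- n : rat).
Context (eta v0 : Q) (eta_neq0 : eta != 0).
Local Notation P1 := (P1 p_pr).

Definition hcoord (x : P1) : Q * Q := if x is Some x then (x - v0, eta) else (1, 0).

Definition P1_ball n (x : P1) : set P1 :=
  [set y | pdist (hcoord x) (hcoord y) <= radius n].

Lemma P1_ballE n x y :
  P1_ball n x y = (pdist (hcoord x) (hcoord y) <= radius n) :> Prop.
Proof. by []. Qed.

Let abs_eta_gt0 : 0 < abs eta. Proof. by rewrite Qp_abs_gt0. Qed.

Lemma hcoord_neq0 x : hcoord x != 0.
Proof.
case: x => [x|]; apply/eqP => -[].
  by move=> _ /eqP; rewrite (negPf eta_neq0).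
by move/eqP; rewrite oner_eq0.
Qed.

Lemma vabs_hcoord_gt0 x : 0 < vabs (hcoord x).
Proof. by rewrite vabs_gt0 hcoord_neq0. Qed.

Lemma pdist_hcoord_Some x y : pdist (hcoord (Some x)) (hcoord (Some y)) =
  abs eta * abs (x - y) / (vabs (hcoord (Some x)) * vabs (hcoord (Some y))).
Proof.
by rewrite /pdist -Qp_absM /wedge /=; congr (abs _ / _); ring.
Qed.

Lemma pdist_hcoord_None x :
  pdist (hcoord None) (hcoord (Some x)) = abs eta / vabs (hcoord (Some x)).
Proof. by rewrite pdist_one. Qed.

Lemma P1_ball_refl n x : P1_ball n x x.
Proof. by rewrite /P1_ball /= pdistxx ltW // (radius_gt0 p_pr). Qed.

Lemma P1_ball_sym n x y : P1_ball n x y -> P1_ball n y x.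
Proof. by rewrite /P1_ball /= pdistC. Qed.

Lemma P1_ball_trans n x y z : P1_ball n x y -> P1_ball n y z -> P1_ball n x z.
Proof. by apply: pdist_ultra; exact: hcoord_neq0. Qed.

Lemma P1_ball_eq n x y : P1_ball n x y -> P1_ball n x = P1_ball n y.
Proof.
move=> xy; apply/seteqP; split=> z; last exact: P1_ball_trans xy.
exact/P1_ball_trans/P1_ball_sym.
Qed.

Lemma P1_ball_anti n x : P1_ball n.+1 x `<=` P1_ball n x.
Proof. by move=> y /le_trans; apply; rewrite (radius_le p_pr). Qed.

Lemma P1_ball_nbhs_Some n x : nbhs x [set y | P1_ball n (Some x) (Some y)].
Proof.
have V0 := vabs_hcoord_gt0 (Some x).
have [m mn] := radius_small p_pr (mulr_gt0 (radius_gt0 p_pr n) V0).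
apply/Qp_nbhsP; exists m => y xy; rewrite /P1_ball /= pdist_hcoord_Some.
have V'0 := vabs_hcoord_gt0 (Some y).
rewrite ler_pdivrMr ?mulr_gt0 // mulrA mulrC.
apply: ler_pM; rewrite ?Qp_abs_ge0 //; last exact: (abs2_le_vabs (hcoord (Some y))).
exact: le_trans xy (ltW mn).
Qed.

Lemma P1_ball_sub_Some n (x : Q) : exists m, forall z, P1_ball m (Some x) z ->
  exists2 y, z = Some y & abs (x - y) <= radius n.
Proof.
have V0 := vabs_hcoord_gt0 (Some x); set V := vabs _ in V0.
(* The first bound excludes infinity and any [y] whose coordinates are larger than those of [x]; the
   second then turns projective closeness into [|x - y| <= radius n]. *)
have e0 : 0 < Num.min (abs eta / V) (radius n * abs eta / V ^+ 2).
  by rewrite lt_min !divr_gt0 ?mulr_gt0 ?exprn_gt0 ?(radius_gt0 p_pr).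
have [m] := radius_small p_pr e0; rewrite lt_min => /andP[m1 m2].
exists m => -[y|] xz; last first.
  by move: xz; rewrite /P1_ball /= pdistC pdist_hcoord_None leNgt m1.
exists y => //; move: xz; rewrite /P1_ball /= pdist_hcoord_Some -/V => xz.
have V'0 := vabs_hcoord_gt0 (Some y); set V' := vabs _ in V'0 xz *.
move: xz; rewrite ler_pdivrMr ?mulr_gt0 // => xz.
have VV : V' <= V.
  rewrite leNgt; apply/negP => VV.
  have V'E : V' = abs (y - v0).
    apply: max_l; rewrite leNgt; apply/negP => ye; move: VV.
    by rewrite /V' /vabs max_r ?(ltW ye) // ltNge (abs2_le_vabs (hcoord (Some x))).
  have exy : abs (x - y) = V'.
    have -> : x - y = - (y - v0) + (x - v0) by ring.
    rewrite Qp_absD_dom Qp_absN -V'E //.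
    exact: le_lt_trans (abs1_le_vabs (hcoord (Some x))) VV.
  by move: xz; rewrite exy mulrA ler_pM2r // leNgt -ltr_pdivlMr // m1.
have xz' : abs eta * abs (x - y) <= radius m * V ^+ 2.
  apply: le_trans xz _; rewrite ler_pM2l ?(radius_gt0 p_pr) // expr2.
  by rewrite ler_pM2l.
move: m2; rewrite ltr_pdivlMr ?exprn_gt0 // => m2.
by rewrite -(ler_pM2l abs_eta_gt0) [leRHS]mulrC; exact: le_trans xz' (ltW m2).
Qed.

(** A bound of at least [1] persists on a ball of radius [1] by the ultrametric inequality, so
    boundedness is a local property and compactness makes it uniform. *)
Lemma compact_bounded (K : set Q) : compact K ->
  exists k, forall x, K x -> abs (x - v0) <= p%:R ^+ k.
Proof.
move=> /compact_near_coveringP/(_ nat \oo (fun k x => abs (x - v0) <= p%:R ^+ k) _) [].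
  move=> x Kx.
  have [k xk] : exists k, abs (x - v0) <= p%:R ^+ k.
    have [m xm] : exists m : nat, abs (x - v0) < m%:R.
      by exists (Num.truncn (abs (x - v0))).+1; exact: truncnS_gt.
    exists m; apply: le_trans (ltW xm) _; rewrite -natrX ler_nat ltnW //.
    by rewrite ltn_expl // prime_gt1.
  exists ([set y | abs (x - y) <= radius 0], [set j | (k <= j)%N]).
    split=> /=; first by apply/Qp_nbhsP; exists 0%N.
    by exists k.
  move=> [y j] /= [xy kj].
  have -> : y - v0 = (x - v0) - (x - y) by ring.
  have pj : 1 <= p%:R ^+ j :> rat by rewrite exprn_ege1 // ltW // (prime_natr_gt1 p_pr).
  apply: Qp_absB_le.
    by apply: le_trans xk _; rewrite ler_eXn2l // (prime_natr_gt1 p_pr).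
  by apply: le_trans pj; move: xy; rewrite expr0 invr1.
by move=> k _ /(_ k (leqnn k)) Kk; exists k.
Qed.

(** The projective distance induces the topology of the one-point compactification: at infinity,
    small balls avoid a given compact set because that set is bounded. *)
Lemma P1_ballP (x : P1) (U : set P1) : nbhs x U <-> exists n, P1_ball n x `<=` U.
Proof.
case: x => [x|].
  split=> [|[n nU]].
    move=> xU; have /Qp_nbhsP[n nU] : nbhs x [set y | U (Some y)] by exact: xU.
    have [m mx] := P1_ball_sub_Some n x; exists m => z /mx[y -> xy]; exact: nU.
  have : nbhs x [set y | U (Some y)].
    by apply: filterS (P1_ball_nbhs_Some n x) => y; exact: nU.
  by [].
split.
  case=> K [cK _] KU; have [k Kk] := compact_bounded cK.
  have e0 : 0 < Num.min 1 (abs eta * radius k).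
    by rewrite lt_min ltr01 mulr_gt0 ?(radius_gt0 p_pr).
  have [m] := radius_small p_pr e0; rewrite lt_min => /andP[m1 m2].
  exists m => -[y|] yz; apply: KU; last by right.
  left; exists y => // Ky.
  move: yz; rewrite /P1_ball /= pdist_hcoord_None.
  rewrite ler_pdivrMr ?vabs_hcoord_gt0 // leNgt => /negP; apply.
  have key a : a <= p%:R ^+ k -> 0 <= a -> radius m * a < abs eta.
    move=> ak a0; apply: le_lt_trans (ler_wpM2l (ltW (radius_gt0 p_pr m)) ak) _.
    by rewrite -ltr_pdivlMr // exprn_gt0 // (prime_natr_gt0 p_pr).
  rewrite {1}/vabs /=; case: (leP (abs (y - v0)) (abs eta)) => _.
    by rewrite gtr_pMl.
  by apply: key; rewrite ?Qp_abs_ge0 //; exact: Kk.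
(* With this [c] the complement of the compact ball is [|y - v0| > |eta| * p ^ n], which lies in the
   ball of index [n] at infinity. *)
case=> n nU; pose c := p%:R ^+ n / eta.
have p0 : (p%:R : Q) != 0 by rewrite -Qp_abs_neq0 Qp_abs_prime gt_eqF // (radius_gt0 p_pr).
have c0 : c != 0 by rewrite mulf_neq0 ?invr_eq0 ?expf_neq0.
exists [set y | abs (c * (y - v0)) <= 1].
  by split; [exact: Qp_compact_ball|exact: Qp_closed_ball].
move=> z [[y ny <-]|->]; apply: nU; last exact: P1_ball_refl.
rewrite /P1_ball /= pdist_hcoord_None ler_pdivrMr ?vabs_hcoord_gt0 //.
move: ny => /= /negP; rewrite -ltNge Qp_absM Qp_absMdiv Qp_absX Qp_abs_prime expr1 exprVn.
rewrite mulrAC ltr_pdivlMr // mul1r => ye.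
apply: le_trans (ltW ye) _; rewrite ler_pM2l ?(radius_gt0 p_pr) //.
exact: (abs1_le_vabs (hcoord (Some y))).
Qed.

(** The charts [h z] and [h (1 / z)]; restricted to [|z| <= 1] and [|z| < 1], they parametrize the
    two pieces in the definition of [mu_hat]. *)
Definition chart0 (z : Q) : P1 := P1_affine eta v0 (P1_of z).
Definition chart1 (z : Q) : P1 := P1_affine eta v0 (P1_inv (P1_of z)).

Lemma hcoord_chart0 z : hcoord (chart0 z) = qscale eta (z, 1).
Proof. by rewrite /chart0 /= addrK /qscale /= mulr1. Qed.

Lemma hcoord_chart1 z : exists2 s, s != 0 & hcoord (chart1 z) = qscale s (1, z).
Proof.
rewrite /chart1 /=; have [->|z0] := eqVneq z 0.
  by exists 1; rewrite ?oner_eq0 // /qscale /= mulr1 mulr0.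
exists (eta / z); first by rewrite mulf_neq0 ?invr_eq0.
by rewrite /= addrK /qscale /= mulr1 divfK.
Qed.

Lemma P1_chart x : (exists2 z, abs z <= 1 & x = chart0 z) \/
  (exists2 z, abs z < 1 & x = chart1 z).
Proof.
case: x => [x|]; last first.
  by right; exists 0; rewrite ?Qp_abs0 // /chart1 /= eqxx.
have xE : x = eta * ((x - v0) / eta) + v0 by rewrite mulrC divfK // subrK.
set z := (x - v0) / eta in xE; have [z1|z1] := leP (abs z) 1.
  by left; exists z => //; rewrite /chart0 /= -xE.
right; have z0 : z != 0 by rewrite -Qp_abs_gt0; exact: lt_trans z1.
exists z^-1; last by rewrite /chart1 /= invr_eq0 (negPf z0) /= invrK -xE.
by have := Qp_absMdiv 1 z; rewrite mul1r Qp_abs1 mul1r => ->; rewrite invf_lt1 // (lt_trans _ z1).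
Qed.

Lemma vabs_z1 (z : Q) : abs z <= 1 -> vabs (z, 1) = 1.
Proof. by move=> z1; rewrite /vabs /= Qp_abs1 max_r. Qed.

Lemma vabs_1z (z : Q) : abs z <= 1 -> vabs (1, z) = 1.
Proof. by move=> z1; rewrite /vabs /= Qp_abs1 max_l. Qed.

Lemma P1_ball_chart0 n z z' : abs z <= 1 -> abs z' <= 1 ->
  P1_ball n (chart0 z) (chart0 z') <-> abs (z - z') <= radius n.
Proof.
move=> z1 z1'; rewrite P1_ballE !hcoord_chart0 pdist_scalel // pdist_scaler //.
by rewrite /pdist /wedge /= !vabs_z1 // !mulr1 ?mul1r ?invr1 ?mulr1.
Qed.

Lemma P1_ball_chart1 n z z' : abs z <= 1 -> abs z' <= 1 ->
  P1_ball n (chart1 z) (chart1 z') <-> abs (z - z') <= radius n.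
Proof.
move=> z1 z1'; rewrite P1_ballE.
have [s s0 ->] := hcoord_chart1 z; have [s' s0' ->] := hcoord_chart1 z'.
rewrite pdist_scalel // pdist_scaler //.
by rewrite /pdist /wedge /= !vabs_1z // !mul1r mulr1 invr1 mulr1 Qp_absB_sym.
Qed.

(** Points from the two charts are at distance [|z * z' - 1| = 1], so only a ball of index at least
    one separates them. *)
Lemma P1_ball_chart01 n z z' : abs z <= 1 -> abs z' < 1 ->
  P1_ball n.+1 (chart0 z) (chart1 z') -> False.
Proof.
move=> z1 z1'; rewrite P1_ballE hcoord_chart0.
have [s' s0' ->] := hcoord_chart1 z'.
rewrite pdist_scalel // pdist_scaler // /pdist /wedge /=.
rewrite (vabs_z1 z1) (vabs_1z (ltW z1')) !mulr1 ?invr1 ?mulr1 ?mul1r addrC.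
rewrite Qp_absD_dom Qp_absN Qp_abs1.
  by rewrite leNgt (lt_le_trans (radiusS_lt p_pr n)) // (radius_le1 p_pr).
by rewrite Qp_absM; apply: le_lt_trans z1'; rewrite ler_piMl ?Qp_abs_ge0.
Qed.

Lemma P1_ball_continuous (f : Q -> P1) :
  (forall z n, exists m, forall z', abs (z - z') <= radius m -> P1_ball n (f z) (f z')) ->
  continuous f.
Proof.
move=> fc z U /P1_ballP[n nU]; have [m mf] := fc z n.
by apply/Qp_nbhsP; exists m => z' /mf; exact: nU.
Qed.

Lemma chart0_continuous : continuous chart0.
Proof.
apply: P1_ball_continuous => z n; exists n => z' zz'.
rewrite P1_ballE !hcoord_chart0 pdist_scalel // pdist_scaler //.
rewrite /pdist /wedge /= !mulr1 mul1r ler_pdivrMr; last first.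
  by rewrite mulr_gt0 // vabs_gt0; apply/eqP => -[_ /eqP]; rewrite oner_eq0.
apply: le_trans zz' _; rewrite ler_peMr ?(ltW (radius_gt0 p_pr n)) //.
have v1 (t : Q) : 1 <= vabs (t, 1) by rewrite /vabs /= Qp_abs1 le_max lexx orbT.
by rewrite -[1]mulr1 ler_pM.
Qed.

Lemma chart1_continuous : continuous chart1.
Proof.
apply: P1_ball_continuous => z n; exists n => z' zz'.
rewrite P1_ballE.
have [s s0 ->] := hcoord_chart1 z; have [s' s0' ->] := hcoord_chart1 z'.
rewrite pdist_scalel // pdist_scaler //.
rewrite /pdist /wedge /= !mulr1 mul1r Qp_absB_sym ler_pdivrMr; last first.
  by rewrite mulr_gt0 // vabs_gt0; apply/eqP => -[/eqP]; rewrite oner_eq0.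
apply: le_trans zz' _; rewrite ler_peMr ?(ltW (radius_gt0 p_pr n)) //.
have v1 (t : Q) : 1 <= vabs (1, t) by rewrite /vabs /= Qp_abs1 le_max lexx.
by rewrite -[1]mulr1 ler_pM.
Qed.

End ProjectiveBalls.

(* The matrix of [h^-1 \o moebius a b c d \o h] is that of the multiplication by
   [(a + d) / 2 + c * eta * w], where [w ^ 2 = Delta / (2 * c * eta) ^ 2]. *)
Lemma moebius_conjugation_entry (F : fieldType) (a b c d eta x : F) :
  2 != 0 :> F -> c != 0 -> eta != 0 ->
  let v0 := (a - d) / (2 * c) in
  let N := ((d - a) ^+ 2 + 4 * b * c) / (2 * c * eta) ^+ 2 in
  ((a + d) / 2) * (x - v0) + N * (c * eta) * eta = a * x + b - v0 * (c * x + d).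
Proof. by move=> two0 c0 eta0 /=; field; rewrite two0 c0 eta0. Qed.

Lemma moebius_conjugation_diag (F : fieldType) (a c d eta x : F) :
  2 != 0 :> F -> c != 0 ->
  (a + d) / 2 * eta + c * eta * (x - (a - d) / (2 * c)) = eta * (c * x + d).
Proof. by move=> two0 c0; field; rewrite two0 c0. Qed.

Lemma moebius_conjugation_infty (F : fieldType) (a c d : F) :
  2 != 0 :> F -> c != 0 -> a / c - (a - d) / (2 * c) = c^-1 * ((a + d) / 2).
Proof. by move=> two0 c0; field; rewrite two0 c0. Qed.

(** * The Moebius map as multiplication in the quadratic extension *)

Section MoebiusAction.
Context (p : nat) (p_pr : prime p) (p_ge3 : (3 <= p)%N).
Local Notation Q := (Qp p_pr).
Local Notation abs := (@Qp_abs p p_pr).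
Context (a b c d eta : Q) (c_neq0 : c != 0) (eta_neq0 : eta != 0).
Local Notation v0 := ((a - d) / (2 * c)).
Local Notation N := (((d - a) ^+ 2 + 4 * b * c) / (2 * c * eta) ^+ 2).
Local Notation g := ((a + d) / 2, c * eta).
Context (N_unit : abs N = 1) (N_nonsquare : ~ exists x : Q, x ^+ 2 = N).
Local Notation hc := (hcoord eta v0).
Local Notation phi := (moebius a b c d).

Lemma multiplier_neq0 : g != 0 :> Q * Q.
Proof. by apply/eqP => -[_ /eqP]; rewrite mulf_eq0 (negPf c_neq0) (negPf eta_neq0). Qed.

Lemma hcoord_moebius x : exists2 s, s != 0 & hc (phi x) = qscale s (qmul N g (hc x)).
Proof.
have two0 := Qp_2_neq0 p_pr p_ge3.
case: x => [x|] /=; last first.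
  rewrite (negPf c_neq0); exists c^-1; first by rewrite invr_eq0.
  rewrite /qmul /qscale /= !mulr0 !mulr1 addr0 add0r mulKf //.
  by rewrite moebius_conjugation_infty.
have /= e1 := moebius_conjugation_entry a b d x two0 c_neq0 eta_neq0.
have e2 := moebius_conjugation_diag a d eta x two0 c_neq0.
(* If [x] is the pole, the second coordinate of the product vanishes; the first does not, since a
   product of nonzero elements is nonzero. *)
case: eqVneq => [cx0|cx0].
  pose m := qmul N g (hc (Some x)).
  have m2 : m.2 = 0 by rewrite /m /= e2 cx0 mulr0.
  have m1 : m.1 != 0.
    have : m != 0.
      by apply: qmul_neq0 => //; [exact: multiplier_neq0|exact: hcoord_neq0].
    by apply: contra_neq => m10; rewrite [m]surjective_pairing m10 m2.
  exists (m.1)^-1; first by rewrite invr_eq0.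
  by rewrite -/m /qscale m2 mulr0 mulVf.
exists (c * x + d)^-1; first by rewrite invr_eq0.
rewrite /qmul /qscale /= e1 e2; congr pair; last by rewrite mulrCA mulVf // mulr1.
by rewrite [RHS]mulrC [RHS]mulrBl mulfK.
Qed.

Lemma hcoord_iter k x :
  exists2 s, s != 0 & hc (iter k phi x) = qscale s (qmul N (qpow N g k) (hc x)).
Proof.
elim: k => [|k [s s0 IH]].
  by exists 1; rewrite ?oner_eq0 // qmul1 /qscale !mul1r -surjective_pairing.
have [t t0 e] := hcoord_moebius (iter k phi x).
exists (t * s); first by rewrite mulf_neq0.
rewrite iterS e IH /qpow iterS -qmulA -/(qpow N g k).
by congr pair; rewrite /=; ring.
Qed.

(** Multiplication by [hc x] preserves [pdist], so the displacement of [x] under an iterate depends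
    on the power of [g] alone. *)
Lemma pdist_iter k x X : X != 0 ->
  pdist (hc (iter k phi x)) (qmul N X (hc x)) = pdist (qpow N g k) X.
Proof.
move=> X0; have [s s0 ->] := hcoord_iter k x.
by rewrite pdist_scalel // pdist_mulr // hcoord_neq0.
Qed.

Lemma moebius_ball n x : phi @^-1` P1_ball eta v0 n (phi x) = P1_ball eta v0 n x.
Proof.
apply/funext => y; rewrite /P1_ball /=.
have [s s0 ->] := hcoord_moebius x; have [t t0 ->] := hcoord_moebius y.
by rewrite pdist_scalel // pdist_scaler // pdist_mull // multiplier_neq0.
Qed.

(* A minimal set is a union of balls of some radius: some power of the
   multiplier is close to 1 but not scalar, and its powers are dense in a ball. *)
Lemma minimal_moebius_ball (B : set (P1 p_pr)) :
  (forall k, (0 < k)%N -> (qpow N g k).2 != 0) ->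
  is_minimal_subsystem phi B ->
  exists n, forall y, B y -> P1_ball eta v0 n y `<=` B.
Proof.
move=> g2 Bmin.
have nbP := P1_ballP v0 eta_neq0.
have [x Bx] : B !=set0 by case: Bmin => [[]].
have Bphi y : B y -> B (phi y) by move=> By; case: Bmin => [[_ _ +] _]; apply; exists y.
(* Recurrence of [x] makes a power of [g] close to [1]. Using the orbit of [phi x] makes the
   exponent [k.+1] positive, as non-scalarity requires. *)
have := Bx; rewrite {1}(Bmin.2 _ (Bphi _ Bx)).
move/(closure_ballP nbP)/(_ 1%N) => [_ [[k _ <-]]].
rewrite -iterSr /P1_ball /= pdistC => xk.
pose G := qpow N g k.+1.
have G0 : G != 0 by apply: qpow_neq0 => //; exact: multiplier_neq0.
have G1 : pdist qone G < 1.
  have e := pdist_iter k.+1 x (qone_neq0 p_pr).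
  rewrite qmul1 in e; rewrite pdistC -e.
  apply: le_lt_trans xk _; apply: lt_le_trans (radiusS_lt p_pr 0) _.
  by rewrite expr0 invr1.
have G2 : 0 < pdist qone G.
  by rewrite pdist_one divr_gt0 ?vabs_gt0 // Qp_abs_gt0 g2.
have [n nG] : exists n, pdist qone G = p%:R ^- n.
  have [_ G10] := pdist_one_lt1 G0 G1.
  rewrite pdist_slope //; apply: Qp_abs_radius; last by rewrite -pdist_slope // ltW.
  by rewrite mulf_neq0 ?invr_eq0 // g2.
exists n => y By z yz; rewrite (Bmin.2 _ By); apply/(closure_ballP nbP) => m.
(* Up to a scalar, [A] is the quotient of [hc z] by [hc y]: multiplication by it carries [y] to [z],
   and approximating [A] by powers of [G] approximates [z] by the orbit of [y]. *)
pose A := qmul N (hc z) (qconj (hc y)).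
have y0 := hcoord_neq0 v0 eta_neq0 y; have z0 := hcoord_neq0 v0 eta_neq0 z.
have A0 : A != 0 by rewrite qmul_neq0 // qconj_neq0.
have ny := qnorm_neq0 p_ge3 N_unit N_nonsquare y0.
have Ay : qmul N A (hc y) = qscale (qnorm N (hc y)) (hc z).
  rewrite /A -qmulA [qmul N (qconj _) _]qmulC qmul_conj.
  by rewrite /qmul /qscale /= !mulr0 addr0 add0r ![_ * qnorm _ _]mulrC.
have distA X : pdist X A = pdist (qmul N X (hc y)) (hc z).
  by rewrite -[RHS](pdist_scaler _ _ ny) -Ay pdist_mulr.
have [j jm] : exists j, pdist (qpow N G j) A <= pdist qone G * p%:R ^- m.
  apply: qpow_dense => //; first by rewrite G2.
  by rewrite distA qmul1 nG.
exists (iter (k.+1 * j) phi y); split; first by exists (k.+1 * j)%N.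
rewrite /P1_ball /= pdistC.
have [s s0 ->] := hcoord_iter (k.+1 * j) y.
rewrite pdist_scalel // qpowM -distA; apply: le_trans jm _.
by rewrite ler_piMl ?(ltW (radius_gt0 p_pr m)) // ltW.
Qed.

End MoebiusAction.

(** * The measure transported from the two charts *)

Lemma pushforward_measure (R : realType) d d' (S : measurableType d)
    (T : measurableType d') (m : {measure set S -> \bar R}) (f : S -> T) :
  measurable_fun setT f ->
  exists m' : {measure set T -> \bar R}, forall A, m' A = m (f @^-1` A).
Proof.
move=> mf; unshelve eexists (pushforward m f : {measure set T -> \bar R}) => //.
Qed.

Lemma normalized_restriction (R : realType) d (T : measurableType d)
    (m : {measure set T -> \bar R}) (B : set T) :
  measurable B -> m B != 0%E -> m B != +oo%E -> B !=set0 ->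
  exists P : probability T R, forall A, P A = (m (A `&` B) * (fine (m B))^-1%:E)%E.
Proof.
(* The Dirac mass is only the default value of [mnormalize] for total mass zero or infinite, both
   excluded here. *)
move=> mB B0 Boo [x _]; exists (mnormalize (mrestr m mB) (\d_x)%R) => A.
have mT : mrestr m mB setT = m B by rewrite /mrestr setTI.
rewrite -[LHS]/(mnormalize (mrestr m mB) (\d_x)%R A) /mnormalize.
case: ifPn => [/orP[/eqP e|/eqP e]|_]; last by rewrite -mT.
- by move: B0; rewrite -mT; move/eqP.
- by move: Boo; rewrite -mT; move/eqP.
Qed.

Section ChartMeasure.
Context (p : nat) (p_pr : prime p) (R : realType).
Local Notation Q := (Qp p_pr).
Local Notation abs := (@Qp_abs p p_pr).
Local Notation radius n := (p%:R ^- n : rat).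
Local Notation Zp := (@Defs.Zp p p_pr).
Context (mu0 : probability (borel Q) R) (mu0_haar : is_haar_Zp mu0).

Lemma Qp_ball_open n (z : Q) : open [set x | abs (z - x) <= radius n].
Proof.
rewrite openE => x /= zx; apply/Qp_nbhsP; exists n => y xy.
by rewrite /= -[z - y](subrKA x) Qp_absD_le.
Qed.

Lemma Qp_ball_measurable n (z : Q) :
  measurable ([set x | abs (z - x) <= radius n] : set (borel Q)).
Proof. by apply: open_borel_measurable; exact: Qp_ball_open. Qed.

Lemma ZpE : Zp = [set x : Q | abs (0 - x) <= radius 0].
Proof.
by apply/seteqP; split=> x; rewrite /Defs.Zp /= sub0r Qp_absN expr0 invr1.
Qed.

Lemma Zp_measurable : measurable (Zp : set (borel Q)).
Proof. by rewrite ZpE; exact: Qp_ball_measurable. Qed.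

Definition pZp : set Q := [set x | abs x < 1].

Lemma pZpE : pZp = [set x : Q | abs (0 - x) <= radius 1].
Proof.
apply/seteqP; split=> x; rewrite /pZp /= sub0r Qp_absN; first exact: Qp_abs_lt1.
by move=> x1; apply: le_lt_trans x1 (lt_le_trans (radiusS_lt p_pr 0) (radius_le1 p_pr 0)).
Qed.

Lemma pZp_measurable : measurable (pZp : set (borel Q)).
Proof. by rewrite pZpE; exact: Qp_ball_measurable. Qed.

Lemma haar_ball n (z : Q) : abs z <= 1 ->
  mu0 [set x | abs (z - x) <= radius n] = mu0 [set x | abs (0 - x) <= radius n].
Proof.
move=> z1; have [_ inv] := mu0_haar.
rewrite -(inv z [set x | abs (0 - x) <= radius n]) //; last 2 first.
- exact: Qp_ball_measurable.
- move=> x; rewrite /= sub0r Qp_absN /Defs.Zp /= => /le_trans; apply.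
  exact: radius_le1.
congr (mu0 _); apply/seteqP; split=> [x /= zx|_ [y /= y0 <-]].
  by exists (x - z); rewrite /= ?subrKC // sub0r opprB.
by rewrite opprD addrA subrr.
Qed.

(** The translates centred at natural numbers cover [Zp]; were they null, [Zp] would be null by
    countable subadditivity. *)
Lemma haar_ball_neq0 n : mu0 [set x : Q | abs (0 - x) <= radius n] != 0%E.
Proof.
apply/eqP => b0; have [Z1 _] := mu0_haar.
have : (mu0 (Zp) <=
    \sum_(0 <= i <oo) mu0 [set x : Q | (abs (i%:R - x) <= radius n)%R])%E.
  apply: measure_sigma_subadditive.
  - by move=> i; exact: Qp_ball_measurable.
  - exact: Zp_measurable.
  - move=> x /(Zp_residue n)[i xi]; exists i => //=.
    by rewrite Qp_absB_sym.
rewrite Z1 eseries0; first by rewrite leNgt lte01.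
by move=> i _ _; rewrite haar_ball ?b0 // Qp_abs_nat_le1.
Qed.

Context (eta v0 : Q) (eta_neq0 : eta != 0).
Local Notation P1 := (P1 p_pr).
Local Notation chart0 := (chart0 eta v0).
Local Notation chart1 := (chart1 eta v0).
Local Notation D := (P1_ball eta v0).

(** The image of [mu_hat] under [h] without the factor [p / (p + 1)], which cancels in the final
    quotient. *)
Definition chart_measure (A : set P1) : \bar R :=
  (mu0 (Zp `&` chart0 @^-1` A) + mu0 (pZp `&` chart1 @^-1` A))%E.

(** Inversion takes [pZp] to the complement of [Zp], with [0] going to infinity. *)
Lemma mu_hatE (A : set P1) :
  mu_hat mu0 (P1_affine eta v0 @^-1` A) =
  ((p%:R / p.+1%:R)%:E * chart_measure A)%E.
Proof.
rewrite /mu_hat /chart_measure; congr (_ * (mu0 _ + mu0 _))%E.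
  apply/seteqP; split=> z /=; first by move=> [[y yZ [<-]] Az].
  by move=> [zZ Az]; split=> //; exists z.
apply/seteqP; split=> z /= [zZ Az]; split=> //.
  rewrite /pZp /= ltNge; apply/negP => z1; apply: zZ.
  have z0 : z != 0 by rewrite -Qp_abs_gt0; apply: lt_le_trans z1.
  rewrite (negPf z0); exists z^-1 => //; rewrite /Defs.Zp /=.
  have := Qp_absMdiv 1 z; rewrite mul1r Qp_abs1 mul1r => ->.
  by rewrite invf_le1 // (lt_le_trans _ z1).
case: eqVneq => [_ [y _]//|z0] [y yZ [yE]]; move: zZ yZ; rewrite /pZp /Defs.Zp /= yE.
have := Qp_absMdiv 1 z; rewrite mul1r Qp_abs1 mul1r => -> z1.
by rewrite leNgt invf_gt1 ?Qp_abs_gt0 // z1.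
Qed.

Lemma chart_measure_exists : exists nu : {measure set (borel P1) -> \bar R},
  forall A, nu A = chart_measure A.
Proof.
have [nu0 nu0E] := pushforward_measure (mrestr mu0 Zp_measurable)
  (continuous_borel_measurable_fun (@chart0_continuous _ _ _ v0 eta_neq0)).
have [nu1 nu1E] := pushforward_measure (mrestr mu0 pZp_measurable)
  (continuous_borel_measurable_fun (@chart1_continuous _ _ _ v0 eta_neq0)).
exists (measure_add nu0 nu1) => A.
transitivity (nu0 A + nu1 A)%E; first exact: measure_addE.
by rewrite nu0E nu1E /= /mrestr [_ `&` Zp]setIC [_ `&` pZp]setIC.
Qed.

(** A ball of radius less than [1] lies in a single chart, where it is a p-adic ball of the same
    radius; translation invariance removes the centre. *)
Lemma chart_measure_ball n y :
  chart_measure (D n.+1 y) = mu0 [set x : Q | abs (0 - x) <= radius n.+1].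
Proof.
rewrite /chart_measure.
case: (P1_chart v0 eta_neq0 y) => -[z z1 ->].
  rewrite (_ : pZp `&` _ = set0); last first.
    by rewrite -subset0 => w [w1]; exact: P1_ball_chart01.
  rewrite measure0 adde0 -(haar_ball _ z1); congr (mu0 _).
  apply/seteqP; split=> w /=; first by case=> w1 /P1_ball_chart0; exact.
  move=> zw; have w1 : abs w <= 1.
    rewrite (_ : w = z - (z - w)); last by ring.
    by apply: Qp_absB_le => //; apply: le_trans zw (radius_le1 p_pr _).
  by split=> //; apply/P1_ball_chart0.
rewrite (_ : Zp `&` _ = set0); last first.
  rewrite -subset0 => w [w1] /P1_ball_sym; exact: P1_ball_chart01.
rewrite measure0 add0e -(haar_ball _ (ltW z1)); congr (mu0 _).
apply/seteqP; split=> w /=.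
  by case=> w1 /P1_ball_chart1 H; apply: H; [|exact: ltW z1|exact: ltW w1].
move=> zw; have w1 : abs w < 1.
  rewrite (_ : w = z - (z - w)); last by ring.
  apply: le_lt_trans (lt_le_trans (radiusS_lt p_pr 0) (radius_le1 p_pr 0)).
  apply: Qp_absB_le; first exact: Qp_abs_lt1.
  by apply: le_trans zw _; rewrite (radius_le p_pr).
by split=> //; apply/P1_ball_chart1 => //; exact: ltW.
Qed.

Lemma chart_measure_fin A : measurable (A : set (borel P1)) ->
  chart_measure A \is a fin_num.
Proof.
move=> mA; rewrite fin_numD !fin_num_measure //; apply: measurableI.
- exact: pZp_measurable.
- rewrite -[X in measurable X]setTI.
  exact: (continuous_borel_measurable_fun (@chart1_continuous _ _ _ v0 eta_neq0)).
- exact: Zp_measurable.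
- rewrite -[X in measurable X]setTI.
  exact: (continuous_borel_measurable_fun (@chart0_continuous _ _ _ v0 eta_neq0)).
Qed.

End ChartMeasure.

(** * Scalar powers of the multiplier *)

(** Evaluation at [w] and at [- w] are both multiplicative and agree on a scalar power of [X], so
    the quotient of the two values of [X] has [n]-th power [1]. *)
Lemma qpow_scalar_root_of_unity (F L : fieldType) (f : {rmorphism F -> L}) (N : F)
    (w : L) (X : F * F) n : w ^+ 2 = f N ->
  (qpow N X n).2 = 0 -> qpow N X n != 0 ->
  ((f X.1 + f X.2 * w) / (f X.1 - f X.2 * w)) ^+ n = 1.
Proof.
pose emb (w' : L) Y := f Y.1 + f Y.2 * w'.
have embM w' Y Z : w' ^+ 2 = f N -> emb w' (qmul N Y Z) = emb w' Y * emb w' Z.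
  by move=> w2; rewrite /emb /= !rmorphD !rmorphM /= -w2; ring.
have embX w' k : w' ^+ 2 = f N -> emb w' (qpow N X k) = emb w' X ^+ k.
  move=> w2; elim: k => [|k IH].
    by rewrite /emb /= rmorph1 rmorph0 mul0r addr0 expr0.
  by rewrite exprS -IH -embM.
move=> w2 q2 q0.
have w2' : (- w) ^+ 2 = f N by rewrite sqrrN.
have e1 := embX w n w2; have e2 := embX (- w) n w2'.
rewrite /emb q2 rmorph0 !mul0r !addr0 in e1 e2.
rewrite mulrN in e2; rewrite expr_div_n -e1 -e2 divff // fmorph_eq0.
by apply: contra_neq q0 => q1; rewrite [qpow _ _ _]surjective_pairing q1 q2.
Qed.

(** * The invariant measure of a minimal Moebius subsystem *)

Theorem theorem6p2 (R : realType) (p : nat) (p_pr : prime p) (p_ge3 : (3 <= p)%N)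
  (a b c d : Qp p_pr) (ad_bc_neq0 : a * d - b * c != 0)
  (Delta : Qp p_pr) (DeltaE : Delta = (d - a) ^+ 2 + 4 * b * c)
  (Delta_nonsquare : ~ exists x : Qp p_pr, x ^+ 2 = Delta)
  (* L = Qp(sqrt Delta), with its absolute value *)
  (L : fieldExtType (Qp p_pr)) (sqrtD : L) (sqrtDE : sqrtD ^+ 2 = Delta%:A)
  (L_gen : <<1; sqrtD>>%VS = fullv)
  (absL : L -> R) (absL_ext : is_abs_extension absL)
  (lambda : L)
  (lambdaE : lambda = ((a + d)%:A + sqrtD) / ((a + d)%:A - sqrtD))
  (lambda_not_root : forall n : nat, (0 < n)%N -> ~~ n.-unity_root lambda)
  (L_quadratic : \dim (fullv : {vspace L}) = 2%N)
  (L_unramified : is_unramified absL)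
  (r0 : R) (r0E : r0 = absL (sqrtD / c%:A))
  (eta : Qp p_pr) (etaE : ratr (Qp_abs eta) = r0)
  (mu0 : probability (borel (Qp p_pr)) R) (mu0_haar : is_haar_Zp mu0)
  (phi : P1 p_pr -> P1 p_pr) (phiE : phi = moebius a b c d)
  (h : P1 p_pr -> P1 p_pr) (hE : h = P1_affine eta ((a - d) / (2 * c)))
  (B : set (P1 p_pr)) (B_minimal : is_minimal_subsystem phi B) :
  exists sigma : probability (borel (P1 p_pr)) R,
    [/\ is_invariant_measure phi B sigma,
        forall tau : probability (borel (P1 p_pr)) R,
          is_invariant_measure phi B tau ->
          forall A : set (borel (P1 p_pr)), measurable A -> tau A = sigma A &
        forall A : set (borel (P1 p_pr)), measurable A -> A `<=` B ->
          sigma A = (mu_hat mu0 (h @^-1` A) / mu_hat mu0 (h @^-1` B))%E].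
Proof.
subst phi h.
have abs2 := Qp_abs_2 p_pr p_ge3; have two0 := Qp_2_neq0 p_pr p_ge3.
have c0 : c != 0.
  apply/eqP => c0; apply: Delta_nonsquare; exists (d - a).
  by rewrite DeltaE c0 mulr0 addr0.
have Delta0 : Delta != 0.
  by apply/eqP => D0; apply: Delta_nonsquare; exists 0; rewrite D0 expr0n.
have [_ _ absLM _ absLQ] := absL_ext.
(* Choosing [|eta| = r0] amounts to this equality; as [2] is a unit, it makes
   [N = Delta / (2 * c * eta) ^ 2] a unit. *)
have absDelta : Qp_abs Delta = (Qp_abs eta * Qp_abs c) ^+ 2.
  have absLX2 z : absL (z ^+ 2) = absL z ^+ 2 by rewrite !expr2 absLM.
  have cL0 : absL c%:A != 0.
    by rewrite absLQ fmorph_eq0 Qp_abs_neq0.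
  have e : absL sqrtD = ratr (Qp_abs eta) * absL c%:A.
    rewrite etaE r0E -absLM divfK //.
    by rewrite scaler_eq0 negb_or c0 oner_neq0.
  apply: (fmorph_inj (ratr : {rmorphism rat -> R})).
  by rewrite rmorphXn rmorphM /= -absLQ -sqrtDE absLX2 e absLQ.
have eta0 : eta != 0.
  apply: contra_neq Delta0 => e0; apply: Qp_abs_eq0.
  by rewrite absDelta e0 Qp_abs0 mul0r expr0n.
pose q := 2 * c * eta.
have q0 : q != 0 by rewrite !mulf_neq0.
have absq : Qp_abs q = Qp_abs eta * Qp_abs c by rewrite !Qp_absM abs2 mul1r mulrC.
have NE : ((d - a) ^+ 2 + 4 * b * c) / (2 * c * eta) ^+ 2 = Delta / q ^+ 2.
  by rewrite DeltaE.
have N_unit : Qp_abs (((d - a) ^+ 2 + 4 * b * c) / (2 * c * eta) ^+ 2) = 1.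
  rewrite NE Qp_absMdiv Qp_absX absDelta absq divff // expf_neq0 //.
  by rewrite -absq Qp_abs_neq0.
have N_nonsq : ~ exists x : Qp p_pr, x ^+ 2 = ((d - a) ^+ 2 + 4 * b * c) / (2 * c * eta) ^+ 2.
  move=> [x]; rewrite NE => xE; apply: Delta_nonsquare; exists (x * q).
  by rewrite exprMn xE divfK // expf_neq0.
have nonscalar k : (0 < k)%N ->
    (qpow (((d - a) ^+ 2 + 4 * b * c) / (2 * c * eta) ^+ 2) ((a + d) / 2, c * eta) k).2 != 0.
  move=> k0; apply: contra (lambda_not_root k k0) => /eqP q2.
  have [f fE] : exists f : {rmorphism Qp p_pr -> L}, forall x, x%:A = f x.
    by exists (in_alg L).
  pose w := f q^-1 * sqrtD.
  have w2 : w ^+ 2 = f (((d - a) ^+ 2 + 4 * b * c) / (2 * c * eta) ^+ 2).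
    by rewrite NE exprMn sqrtDE fE -rmorphXn -rmorphM exprVn mulrC.
  have g0 := qpow_neq0 p_ge3 N_unit N_nonsq k (multiplier_neq0 a d c0 eta0).
  have := qpow_scalar_root_of_unity w2 q2 g0.
  rewrite unity_rootE => /eqP; congr (_ ^+ _ == 1).
  have f2 : f 2^-1 != 0 by rewrite fmorph_eq0 invr_eq0.
  (* Hence the multiplier evaluates to half of [a + d + sqrtD], and [lambda] is its quotient by the
     conjugate value. *)
  have fw : f (c * eta) * w = f 2^-1 * sqrtD.
    rewrite /w mulrA -rmorphM; congr (f _ * _).
    by rewrite /q -mulrA invfM mulrCA divff ?mulr1 // mulf_neq0.
  rewrite lambdaE fE /= fw rmorphM [f (a + d) * _]mulrC -mulrDr -mulrBr.
  by rewrite -mulf_div divff // mul1r.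
have [n0 n0B] := minimal_moebius_ball p_ge3 c0 eta0 N_unit N_nonsq nonscalar B_minimal.
set v0 := (a - d) / (2 * c) in n0B *.
(* The shift by [n0] keeps balls centred in [B] inside [B]; the additional one makes every radius
   less than [1], as [chart_measure_ball] requires. *)
pose D n := P1_ball eta v0 (n + n0.+1).
have D_refl n x : D n x x by exact: P1_ball_refl.
have D_eq n x y : D n x y -> D n x = D n y by exact: P1_ball_eq.
have D_anti n x : D n.+1 x `<=` D n x by exact: P1_ball_anti.
have D_nbhs x U : nbhs x U <-> exists n, D n x `<=` U.
  rewrite (P1_ballP v0 eta0); split=> [[n nU]|[n nU]]; last by exists (n + n0.+1)%N.
  exists n; apply: subset_trans nU; apply: (ball_anti (D := P1_ball eta v0)); last exact: leq_addr.
  by move=> *; exact: P1_ball_anti.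
have phi_D n y : moebius a b c d @^-1` D n (moebius a b c d y) = D n y.
  exact: (moebius_ball p_ge3 c0 eta0 N_unit N_nonsq).
have DB n y : B y -> D n y `<=` B.
  move=> By; apply: subset_trans (n0B y By).
  apply: (ball_anti (D := P1_ball eta v0)); last by rewrite addnS ltnW // ltnS leq_addl.
  by move=> *; exact: P1_ball_anti.
have mB := minimal_measurable B_minimal.
have mD n y : measurable (D n y : set (borel (P1 p_pr))) by exact: ball_measurable.
have [nu nuE] := chart_measure_exists mu0 v0 eta0.
have nuD n y : nu (D n y) = mu0 [set x : Qp p_pr | Qp_abs (0 - x) <= p%:R ^- (n + n0.+1)].
  by rewrite nuE /D addnS; exact: chart_measure_ball.
have nu_fin A : measurable (A : set (borel (P1 p_pr))) -> nu A \is a fin_num.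
  by move=> mA; rewrite nuE; exact: chart_measure_fin.
have [x Bx] : B !=set0 by case: B_minimal => [[]].
(* [B] contains a ball, and balls have positive mass. *)
have nuB0 : nu B != 0%E.
  apply/eqP => nB0; have := haar_ball_neq0 mu0_haar (0 + n0.+1); rewrite -(nuD 0%N x).
  by move/eqP; apply; apply: (subset_measure0 (mD _ _) mB (DB _ _ Bx) nB0).
have nuBoo : nu B != +oo%E by have := nu_fin _ mB; rewrite fin_numE => /andP[].
have [sigma sigmaE] := normalized_restriction mB nuB0 nuBoo (ex_intro _ x Bx).
have sigmaB : sigma B = 1%E.
  rewrite sigmaE setIid -[X in (X * _)%E](fineK (nu_fin _ mB)) -EFinM divff //.
  by rewrite fine_eq0 // nu_fin.
have sigmaD n y z : B y -> B z -> sigma (D n y) = sigma (D n z).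
  move=> By Bz; rewrite !sigmaE !(setIidl (DB n _ _)) //.
  by rewrite !nuD.
exists sigma; split.
- exact: (ball_constant_invariant D_refl D_eq D_anti D_nbhs phi_D B_minimal).
- move=> tau tau_inv A mA.
  apply: (minimal_ball_constant_unique D_refl D_eq D_anti D_nbhs B_minimal) => //.
  + by case: tau_inv.
  + exact: (invariant_ball_constant D_eq D_nbhs phi_D B_minimal).
- move=> A mA AB; rewrite sigmaE (setIidl AB) !mu_hatE -!nuE.
  have [u nuA] : exists u, nu A = u%:E by exists (fine (nu A)); rewrite fineK // nu_fin.
  have [v nuB] : exists v, nu B = v%:E by exists (fine (nu B)); rewrite fineK // nu_fin.
  have v_neq0 : v != 0 by rewrite -eqe -nuB.
  have k0 : p%:R / p.+1%:R != 0 :> R.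
    by rewrite mulf_neq0 ?invr_eq0 ?pnatr_eq0 // -lt0n prime_gt0.
  rewrite nuA nuB -!EFinM inver (negPf (mulf_neq0 k0 v_neq0)) /= -EFinM; congr (_%:E).
  by rewrite -mulf_div divff // mul1r.
Qed.
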